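(* Let $g\in M^1(\mathbb{R})$ (the Feichtinger algebra) generate a partition of unity, i.e. $$\sum_{s\in\mathbb{Z}} g(x-s)=1\qquad\text{for all } x\in\mathbb{R}.$$ Let $m,n,r\in\mathbb{N}$ and $j\in\{1,\dots,r-1\}$ be such that $$(r-1)m+1<rn+j<rm$$ and such that $rn+j$ and $rm$ are relatively prime. If $\alpha=\tfrac1m$ and $\beta=n+\tfrac{j}{r}$, then the Gabor system $\mathcal{G}(g,\alpha,\beta)$ is not a frame for $L^2(\mathbb{R})$.
   Context: For $\alpha,\beta>0$ and $g\in L^2(\mathbb{R})$, the Gabor system with window $g$ and lattice parameters $\alpha,\beta$ is $\mathcal{G}(g,\alpha,\beta)=\{\,t\mapsto e^{2\pi i\beta l t}\,g(t-\alpha k): k,l\in\mathbb{Z}\,\}$. It is a frame (for $L^2(\mathbb{R})$) if there exist constants $A,B>0$ such that $$A\|f\|_2^2\le\sum_{k,l\in\mathbb{Z}}\bigl|\langle f, e^{2\pi i\beta l\,\cdot}g(\cdot-\alpha k)\rangle\bigr|^2\le B\|f\|_2^2\qquad\text{for all } f\in L^2(\mathbb{R}).$$ The Feichtinger algebra $M^1(\mathbb{R})$ is the space of all $g\in L^2(\mathbb{R})$ whose short-time Fourier transform with Gaussian window, $V_\varphi g(x,\xi)=\int_{\mathbb{R}} g(t)\,\overline{\varphi(t-x)}\,e^{-2\pi i\xi t}\,dt$ with $\varphi(t)=e^{-\pi t^2}$, belongs to $L^1(\mathbb{R}^2)$. Elements of $M^1(\mathbb{R})$ are identified with their continuous representatives,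 and for them the series $\sum_{s\in\mathbb{Z}}g(x-s)$ converges absolutely for every $x\in\mathbb{R}$. *)

(* Defs.v *)
From mathcomp Require Import all_boot all_order all_algebra finmap.
From mathcomp Require Import complex.
From mathcomp Require Import all_classical all_reals all_analysis.
From mathcomp.analysis.showcase Require summability.

Set Implicit Arguments.
Unset Strict Implicit.
Unset Printing Implicit Defensive.

Import Order.TTheory GRing.Theory Num.Theory.
Import numFieldNormedType.Exports.

Local Open Scope classical_set_scope.
Local Open Scope ring_scope.

Definition cmod (R : realType) (z : R[i]) : R := ComplexField.Normc.normc z.

Definition cexpi (R : realType) (a : R) : R[i] := (cos a +i* sin a)%C.

(* The library has no measurable structure on R[i]; Borel measurability of a
   complex function is that of its real and imaginary parts. *)
Definition cmeasurable_fun (R : realType) (d : measure_display)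
    (T : measurableType d) (f : T -> R[i]) : Prop :=
  measurable_fun setT (fun x => complex.Re (f x)) /\
  measurable_fun setT (fun x => complex.Im (f x)).

(* Real-valued integrals return 0 on divergent integrands, so this is
   meaningful only when f is integrable. *)
Definition cintegral (R : realType) (d : measure_display)
    (T : measurableType d) (mu : {measure set T -> \bar R})
    (f : T -> R[i]) : R[i] :=
  (Rintegral mu setT (fun x => complex.Re (f x)) +i*
   Rintegral mu setT (fun x => complex.Im (f x)))%C.

Definition cLnorm (R : realType) (d : measure_display)
    (T : measurableType d) (mu : {measure set T -> \bar R}) (p : R)
    (f : T -> R[i]) : \bar R :=
  Lnorm mu p%:E (fun x => (cmod (f x))%:E).

Definition cLfun (R : realType) (d : measure_display)
    (T : measurableType d) (mu : {measure set T -> \bar R}) (p : R)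
    (f : T -> R[i]) : Prop :=
  cmeasurable_fun f /\ (cLnorm mu p f < +oo)%E.

Definition inner (R : realType) (f h : R -> R[i]) : R[i] :=
  cintegral lebesgue_measure (fun t => f t * (h t)^*%C).

(* Elements of L^2 are represented by functions. The quantity below depends
   only on the a.e. class of f, and is a sum of nonnegative terms, possibly
   +oo. *)
Definition is_frame (R : realType) (I : choiceType)
    (e : I -> R -> R[i]) : Prop :=
  exists A B : R, [/\ 0 < A, 0 < B &
    forall f : R -> R[i], cLfun lebesgue_measure 2 f ->
      (A%:E * cLnorm lebesgue_measure 2 f ^+ 2
         <= \esum_(i in [set: I]) ((cmod (inner f (e i))) ^+ 2)%:E
         <= B%:E * cLnorm lebesgue_measure 2 f ^+ 2)%E].

Definition gabor_system (R : realType) (g : R -> R[i]) (alpha beta : R)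
    (kl : int * int) (t : R) : R[i] :=
  cexpi (2 * pi * beta * kl.2%:~R * t) * g (t - alpha * kl.1%:~R).

Definition gaussian (R : realType) (t : R) : R[i] :=
  (expR (- pi * t ^+ 2))%:C%C.

Definition stft (R : realType) (phi g : R -> R[i]) (p : R * R) : R[i] :=
  cintegral lebesgue_measure
    (fun t => g t * (phi (t - p.1))^*%C * cexpi (- (2 * pi * p.2 * t))).

Definition feichtinger (R : realType) (g : R -> R[i]) : Prop :=
  cLfun lebesgue_measure 2 g /\
  cLfun (lebesgue_measure \x lebesgue_measure)%E 1 (stft (@gaussian R) g).

(* Unconditional convergence (along the finite subsets of I), which in R[i] is
   the same as absolute convergence. R[i]^o carries the topology of R[i]. *)
Definition has_csum (R : realType) (I : choiceType) (u : I -> R[i])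
    (l : R[i]) : Prop :=
  (summability.partial_sum u : {fset I} -> R[i]^o) @ summability.totally
    --> (l : R[i]^o).

Definition partition_of_unity (R : realType) (g : R -> R[i]) : Prop :=
  forall x : R, has_csum (fun s : int => g (x - s%:~R)) 1.

(* Main.v *)
Require Import Defs.
From mathcomp Require Import all_boot all_order all_algebra finmap.
From mathcomp Require Import complex.
From mathcomp Require Import all_classical all_reals all_analysis.
From mathcomp Require Import measurable_realfun ring lra zify.
From mathcomp.analysis.showcase Require summability.

Import Order.TTheory GRing.Theory Num.Theory.
Import numFieldNormedType.Exports.

(** Put [p = r n + j], so that [alpha = 1 / m] and [beta = p / r].  The
    obstruction is a nearly degenerate combination of translates of [g]: for
    every real [t] there are [p]-periodic coefficients [d], not all zero, for
    which [\sum_s d_s g (t + s r / p - k / m)] is almost zero for every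
    integer [k].

    This is a dimension count.  Since [d] has period [p], that sum depends on
    [k] only modulo [r m], and it is the [k]-th row of an [r m] by [p] matrix
    applied to [d], whose entries are the sums of [g] over cosets of [r Z].
    Let [k] run over a residue class modulo [m]: the [r] corresponding cosets
    of [r Z] fill a coset of [Z], so the partition of unity makes the [r] rows
    add up to the all-ones row.  Hence it is enough to ask that [\sum_s d_s = 0]
    and that the rows [m <= k < r m] annihilate [d]: the remaining [m] rows
    then do so as well.  These are [(r - 1) m + 1 < p] equations for [p]
    unknowns ([kernel_vector]).  Coset sums are replaced by finite truncations
    throughout, and [d] by a rational vector, at the price of a small error.

    Cutting such a [d] down to [N] periods leaves, for the square sum over [k],
    only boundary effects and these small errors, so that it is at most
    [eta N] times the square sum of [d] over a period, with [eta] as small as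
    desired ([block_sums_le], [degenerate_combination]).

    To contradict the lower frame bound, let [c] be the truncated
    coefficients, [E] a measurable subset of the period [[0, 1 / beta[], and
    test the frame on [f = \sum_i conj(c_i) 1_E(x - i / beta)].  Folding the
    integral onto one period turns the inner products of [f] with the Gabor
    system at a fixed [k] into the Fourier coefficients of
    [conj (\sum_i c_i g (t + i / beta - alpha k))] on [E], and Bessel's
    inequality bounds the frame sum of [f] by [1 / beta] times the integral
    over [E] of the square sum over [k].  If that square sum is small on all of
    [E], the lower frame bound forces [E] to be null ([degenerate_set_null]).
    Rational coefficients and cut-offs [N] form a countable set, and the
    corresponding sets [E] cover [[0, 1 / beta[], which is not null. *)

Local Open Scope classical_set_scope.
Local Open Scope ring_scope.

(** * The modulus of a complex number *)
Lemma le_of_eq {R : realType} (x y : R) : x = y -> x <= y.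
Proof. by move->. Qed.

Section Modulus.
Context {R : realType}.
Implicit Types z w : R[i].

Lemma cmod_ge0 z : 0 <= cmod z.
Proof. by rewrite /cmod; case: z => a b; exact: sqrtr_ge0. Qed.

Lemma cmod0 : cmod (0 : R[i]) = 0.
Proof. exact: ComplexField.Normc.normc0. Qed.

Lemma cmodD z w : cmod (z + w) <= cmod z + cmod w.
Proof. exact: le_normcD. Qed.

Lemma cmodM z w : cmod (z * w) = cmod z * cmod w.
Proof. exact: ComplexField.Normc.normcM. Qed.

Lemma cmodN z : cmod (- z) = cmod z.
Proof. exact: normcN. Qed.

Lemma cmodB z w : cmod (z - w) <= cmod z + cmod w.
Proof. by rewrite -(cmodN w) cmodD. Qed.

Lemma cmod_eq0 z : cmod z = 0 -> z = 0.
Proof. exact: ComplexField.Normc.eq0_normc. Qed.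

Lemma sqr_cmod z : cmod z ^+ 2 = complex.Re z ^+ 2 + complex.Im z ^+ 2.
Proof. by case: z => a b; rewrite /cmod /= sqr_sqrtr // addr_ge0 ?sqr_ge0. Qed.

Lemma cmod_conj z : cmod z^*%C = cmod z.
Proof. by case: z => a b; rewrite /cmod /= sqrrN. Qed.

Lemma mulc_conj z : z * z^*%C = ((cmod z ^+ 2)%:C)%C.
Proof.
rewrite sqr_cmod; case: z => a b /=; apply/eqP; rewrite eq_complex /=.
by apply/andP; split; apply/eqP; ring.
Qed.

Lemma conjc_mul z w : (z * w)^*%C = z^*%C * w^*%C.
Proof. exact: rmorphM. Qed.

Lemma conjc_sub z w : (z - w)^*%C = z^*%C - w^*%C.
Proof. exact: rmorphB. Qed.

Lemma conjc_sum (I : Type) (s : seq I) (F : I -> R[i]) :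
  (\sum_(i <- s) F i)^*%C = \sum_(i <- s) (F i)^*%C.
Proof. exact: rmorph_sum. Qed.

Lemma cmod_real (x : R) : cmod (x%:C)%C = `|x|.
Proof. by rewrite /cmod /= expr0n addr0 sqrtr_sqr. Qed.

Lemma le_Re_cmod z : `|complex.Re z| <= cmod z.
Proof.
rewrite -(@ler_pXn2r _ 2) ?nnegrE ?cmod_ge0 // sqr_cmod real_normK ?num_real //.
by rewrite lerDl sqr_ge0.
Qed.

Lemma le_Im_cmod z : `|complex.Im z| <= cmod z.
Proof.
rewrite -(@ler_pXn2r _ 2) ?nnegrE ?cmod_ge0 // sqr_cmod real_normK ?num_real //.
by rewrite lerDr sqr_ge0.
Qed.

Lemma cmod_le_ReIm z : cmod z <= `|complex.Re z| + `|complex.Im z|.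
Proof.
rewrite -(@ler_pXn2r _ 2) ?nnegrE ?cmod_ge0 ?addr_ge0 // sqr_cmod.
rewrite -(real_normK (num_real (complex.Re z))).
rewrite -(real_normK (num_real (complex.Im z))).
by rewrite sqrrD lerD2r lerDl mulrn_wge0 // mulr_ge0.
Qed.

Lemma cmod_sum (I : Type) (s : seq I) (P : pred I) (F : I -> R[i]) :
  cmod (\sum_(i <- s | P i) F i) <= \sum_(i <- s | P i) cmod (F i).
Proof.
elim/big_ind2: _ => //; first by rewrite cmod0.
by move=> x1 x2 y1 y2 h1 h2; rewrite (le_trans (cmodD _ _)) // lerD.
Qed.

Lemma Re_sum (I : Type) (s : seq I) (P : pred I) (F : I -> R[i]) :
  complex.Re (\sum_(i <- s | P i) F i) = \sum_(i <- s | P i) complex.Re (F i).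
Proof.
by rewrite (big_morph (@complex.Re R) (id1 := 0) (op1 := +%R)) // => -[a b] [].
Qed.

Lemma Im_sum (I : Type) (s : seq I) (P : pred I) (F : I -> R[i]) :
  complex.Im (\sum_(i <- s | P i) F i) = \sum_(i <- s | P i) complex.Im (F i).
Proof.
by rewrite (big_morph (@complex.Im R) (id1 := 0) (op1 := +%R)) // => -[a b] [].
Qed.

Lemma cmod_rat_approx z (e : R) : 0 < e ->
  exists a : rat * rat, cmod (z - (ratr a.1 +i* ratr a.2)%C) <= e.
Proof.
move=> e0; case: z => x y.
have ex1 (u : R) : exists a : rat, `|u - ratr a| <= e / 2.
  have [|a] := @rat_in_itvoo R (u - e / 2) (u + e / 2); first by lra.
  by rewrite in_itv /= => /andP[h1 h2]; exists a; rewrite ler_norml; lra.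
have [a ha] := ex1 x; have [b hb] := ex1 y.
exists (a, b); apply: le_trans (cmod_le_ReIm _) _ => /=.
by rewrite (splitr e) lerD.
Qed.

End Modulus.

(** * Sums of a summable family over blocks of translates *)
Lemma sum_sub_le {R : realType} (T : eqType) (s t : seq T) (F : T -> R) :
  uniq s -> uniq t -> {subset s <= t} -> (forall x, 0 <= F x) ->
  \sum_(x <- s) F x <= \sum_(x <- t) F x.
Proof.
move=> us ut st F0; rewrite [leRHS](bigID (mem s)) /= -[leLHS]addr0.
apply: lerD; last exact: sumr_ge0.
rewrite -[leRHS]big_filter; apply: le_of_eq; apply: perm_big.
apply: uniq_perm; rewrite ?filter_uniq // => x; rewrite mem_filter /=.
by case: (boolP (x \in s)) => // /st ->.
Qed.

Section BlockSums.
Context {R : realType}.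

Lemma count_mem_le (T : eqType) (s t : seq T) : uniq s ->
  \sum_(u <- s) (u \in t)%:R <= (size t)%:R :> R.
Proof.
move=> us; rewrite -natr_sum ler_nat.
have -> : \sum_(u <- s) (u \in t : nat) = count (mem t) s :> nat.
  by elim: s {us} => [|x s IH]; rewrite ?big_nil ?big_cons ?IH.
rewrite -size_filter; apply: uniq_leq_size; first exact: filter_uniq.
by move=> x; rewrite mem_filter => /andP[].
Qed.

(** The family [a] is nearly concentrated on [[-L, L]], where its sum is nearly
    zero.  The window [[-u, N - u[] either contains [[-L, L]], and then the sum
    is small because the total is, or is disjoint from it, and then the sums
    are small in total because the tail is, or meets its boundary.  The last
    case concerns [4 L] values of [u] only, whatever [N] is. *)
Lemma block_sums_le (a : int -> R[i]) (C dl : R) (L N : nat) (s : seq int) :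
  0 <= dl -> 0 <= C ->
  (forall s, uniq s -> \sum_(i <- s) cmod (a i) <= C) ->
  (forall s, uniq s -> all (fun i : int => (L < `|i|)%N) s ->
     \sum_(i <- s) cmod (a i) <= dl) ->
  cmod (\sum_(i < (L * 2).+1) a (i%:Z - L%:Z)) <= dl ->
  uniq s ->
  \sum_(u <- s) cmod (\sum_(i < N) a (i%:Z - u)) ^+ 2
    <= 10 * dl ^+ 2 * N%:R + 4 * L%:R * C ^+ 2.
Proof.
move=> dl0 C0 tot tail sig us.
pose v (u : int) := \sum_(i < N) a (i%:Z - u).
pose w u := \sum_(i < N) (if (L < `|i%:Z - u|)%N then cmod (a (i%:Z - u)) else 0).
have inj_sub (u : int) : injective (fun i : nat => i%:Z - u).
  by move=> i j /addIr [].
have inj_sub' (i : int) : injective (fun u : int => i - u).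
  by move=> u u' /addrI /oppr_inj.
have vC u : cmod (v u) <= C.
  rewrite /v -(big_mkord xpredT (fun i => a (i%:Z - u))).
  apply: le_trans (cmod_sum _ _ _ _) _.
  rewrite -(big_map (fun i : nat => i%:Z - u) xpredT (fun j => cmod (a j))).
  by apply: tot; rewrite map_inj_uniq ?iota_uniq.
have far (u : int) (x y : nat) :
    (forall i, (x <= i < y)%N -> (L < `|i%:Z - u|)%N) ->
    cmod (\sum_(x <= i < y) a (i%:Z - u)) <= dl.
  move=> h; apply: le_trans (cmod_sum _ _ _ _) _.
  rewrite -(big_map (fun i : nat => i%:Z - u) xpredT (fun j => cmod (a j))).
  apply: tail; first by rewrite map_inj_uniq ?iota_uniq.
  by apply/allP => _ /mapP[i + ->]; rewrite mem_index_iota => /h.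
pose inner := [seq i%:Z | i <- iota 0 N].
pose edge := [seq i%:Z - L%:Z | i <- iota 0 (L * 2)] ++
             [seq N%:Z + (i%:Z - L%:Z) | i <- iota 0 (L * 2)].
have w0 u : 0 <= w u.
  by apply: sumr_ge0 => i _; case: ifP => // _; exact: cmod_ge0.
have key (u : int) : cmod (v u) ^+ 2 <=
    9 * dl ^+ 2 * (u \in inner)%:R + C ^+ 2 * (u \in edge)%:R + dl * w u.
  have i0 : 0 <= 9 * dl ^+ 2 * (u \in inner)%:R :> R.
    by rewrite !mulr_ge0 // sqr_ge0.
  have e0 : 0 <= C ^+ 2 * (u \in edge)%:R :> R.
    by rewrite !mulr_ge0 // sqr_ge0.
  have d0 : 0 <= dl * w u by rewrite mulr_ge0.
  case: (boolP (u \in edge)) => [_|ue].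
    rewrite mulr1 -[leLHS]add0r -[leLHS]addr0 lerD // lerD //.
    by rewrite ler_pXn2r ?nnegrE ?cmod_ge0.
  have ue1 : ~~ ((- L%:Z <= u) && (u < L%:Z)).
    apply: contra ue => /andP[h1 h2]; rewrite mem_cat; apply/orP; left.
    by apply/mapP; exists (absz (u + L%:Z)); rewrite ?mem_iota; lia.
  have ue2 : ~~ ((N%:Z - L%:Z <= u) && (u < N%:Z + L%:Z)).
    apply: contra ue => /andP[h1 h2]; rewrite mem_cat; apply/orP; right.
    by apply/mapP; exists (absz (u - N%:Z + L%:Z)); rewrite ?mem_iota; lia.
  rewrite mulr0 addr0.
  case: (boolP ((L%:Z <= u) && (u + L%:Z < N%:Z))) => [/andP[h1 h2]|h].
    have uin : u \in inner.
      by apply/mapP; exists (absz u); rewrite ?mem_iota; lia.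
    rewrite uin mulr1.
    apply: (@le_trans _ _ (9 * dl ^+ 2)); last by rewrite lerDl.
    (* One dl for the central sum, one for the tail on either side. *)
    have -> : 9 * dl ^+ 2 = (3 * dl) ^+ 2 by rewrite exprMn; congr (_ * _); ring.
    rewrite ler_pXn2r ?nnegrE ?cmod_ge0 ?mulr_ge0 //.
    have [n un] : exists n : nat, u = n%:Z by exists (absz u); lia.
    rewrite /v -(big_mkord xpredT (fun i => a (i%:Z - u))).
    rewrite (@big_cat_nat _ _ _ (n - L)%N) //=; last by lia.
    rewrite (@big_cat_nat _ _ _ (n + L).+1 (n - L)%N) //=; try by lia.
    have -> : 3 * dl = dl + (dl + dl) by ring.
    apply: le_trans (cmodD _ _) _; apply: lerD; first by apply: far => i; lia.
    apply: le_trans (cmodD _ _) _; apply: lerD; last by apply: far => i; lia.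
    rewrite -{1}(add0n (n - L)%N) big_addn big_mkord.
    have -> : ((n + L).+1 - (n - L) = (L * 2).+1)%N by lia.
    apply: le_trans sig; apply: le_of_eq.
    by congr cmod; apply: eq_bigr => i _; congr a; lia.
  have uf : (u < - L%:Z) || (N%:Z + L%:Z <= u) by lia.
  rewrite -[leLHS]add0r lerD //.
  have vw : cmod (v u) <= w u.
    apply: le_trans (cmod_sum _ _ _ _) _.
    by apply: ler_sum => i _; rewrite ifT //; have := ltn_ord i; lia.
  have vd : cmod (v u) <= dl.
    rewrite /v -(big_mkord xpredT (fun i => a (i%:Z - u))).
    by apply: far => i; lia.
  by rewrite expr2 ler_pM ?cmod_ge0.
apply: (@le_trans _ _ (\sum_(u <- s)
   (9 * dl ^+ 2 * (u \in inner)%:R + C ^+ 2 * (u \in edge)%:R + dl * w u))).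
  by apply: ler_sum => u _; exact: key.
rewrite !big_split /= -!mulr_sumr.
have -> : 10 * dl ^+ 2 * N%:R + 4 * L%:R * C ^+ 2 =
  9 * dl ^+ 2 * N%:R + C ^+ 2 * (4 * L%:R) + dl * (N%:R * dl) by ring.
apply: lerD; first apply: lerD.
- rewrite ler_wpM2l ?mulr_ge0 ?sqr_ge0 //.
  by apply: le_trans (count_mem_le _ _ _ us) _; rewrite size_map size_iota.
- rewrite ler_wpM2l ?sqr_ge0 //.
  apply: le_trans (count_mem_le _ _ _ us) _.
  by rewrite size_cat !size_map size_iota -natrM ler_nat; lia.
rewrite ler_wpM2l // exchange_big /=.
apply: (@le_trans _ _ (\sum_(i < N) dl)); last first.
  by rewrite sumr_const card_ord mulr_natl.
apply: ler_sum => i _; rewrite -big_mkcond /= -big_filter.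
rewrite -(big_map (fun u : int => i%:Z - u) xpredT (fun j => cmod (a j))).
apply: tail; first by rewrite map_inj_uniq // filter_uniq.
by apply/allP => _ /mapP[u + ->]; rewrite mem_filter => /andP[].
Qed.

End BlockSums.

(** * Wide linear systems *)
Lemma wide_system_kernel (F : fieldType) (a b : nat) (T : 'I_a -> 'I_b -> F) :
  (a < b)%N -> exists d : 'I_b -> F, (exists s, d s != 0) /\
    forall k, \sum_s T k s * d s = 0.
Proof.
move=> ab; pose A : 'M[F]_(b, a) := \matrix_(s, k) T k s.
have /rowV0Pn[v /sub_kermxP vA v0] : kermx A != 0.
  rewrite -mxrank_eq0 mxrank_ker -lt0n subn_gt0.
  exact: leq_ltn_trans (rank_leq_col _) ab.
exists (fun s => v 0 s); split.
  have /rowV0Pn : v != 0 by [].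
  move=> _; apply/existsP; rewrite -negb_forall; apply: contra v0 => /forallP h.
  by apply/eqP/rowP => s; rewrite mxE; apply/eqP/h.
move=> k; have /rowP/(_ k) := vA; rewrite !mxE => vAk.
by rewrite -[RHS]vAk; apply: eq_bigr => s _; rewrite !mxE mulrC.
Qed.

(** * Unconditionally convergent families *)
Section Unconditional.
Context {R : realType}.

Lemma has_csum_finite_approx (I : choiceType) (u : I -> R[i]) (l : R[i])
    (e : R) :
  has_csum u l -> 0 < e ->
  exists s0 : seq I, forall s, uniq s -> {subset s0 <= s} ->
    cmod (\sum_(i <- s) u i - l) <= e.
Proof.
move=> hu e0.
have e0C : (0 : R[i]) < (e%:C)%C by rewrite ltcR.
have FF : Filter (@summability.totally I).
  exact: (@filter_filter _ _ (summability.totally_filter)).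
have [A _ hA] := proj1 (@cvgrPdist_lt R[i] (R[i]^o) _ _ FF _ _) hu _ e0C.
exists (enum_fset A) => s us sub.
have sE : \sum_(i <- s) u i = summability.partial_sum u [fset x in s]%fset.
  rewrite /summability.partial_sum -(big_seq_fsetE _ _ xpredT u) /=.
  apply: perm_big; apply: uniq_perm => // x; by rewrite !inE.
have /hA : [set B | (A `<=` B)%fset] [fset x in s]%fset.
  by rewrite /=; apply/fsubsetP => x /sub; rewrite !inE.
rewrite -sE /= normc_def => /ltW; rewrite lecR => h.
rewrite -cmodN opprB; apply: le_trans h.
by rewrite /cmod; case: (l - _).
Qed.

(** Split the real and imaginary parts according to their signs: each of the
    four pieces is the modulus of a subsum. *)
Lemma sum_cmod_le (I : Type) (u : I -> R[i]) (e : R) (s : seq I) :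
  (forall P : pred I, cmod (\sum_(i <- s | P i) u i) <= e) ->
  \sum_(i <- s) cmod (u i) <= 4 * e.
Proof.
move=> h.
have part (f : R[i] -> R) :
    (forall P, f (\sum_(i <- s | P i) u i) = \sum_(i <- s | P i) f (u i)) ->
    (forall z, `|f z| <= cmod z) ->
    \sum_(i <- s) `|f (u i)| <= 2 * e.
  move=> fsum fle; rewrite (bigID (fun i => 0 <= f (u i))) /=.
  have -> : 2 * e = e + e by ring.
  apply: lerD.
    apply: le_trans (h (fun i => 0 <= f (u i))).
    apply: le_trans (fle _); rewrite fsum.
    apply: le_trans (ler_norm _); apply: le_of_eq.
    by apply: eq_bigr => i /ger0_norm.
  apply: le_trans (h (fun i => ~~ (0 <= f (u i)))).
  apply: le_trans (fle _); rewrite fsum -normrN -sumrN.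
  apply: le_trans (ler_norm _); apply: le_of_eq.
  by apply: eq_bigr => i; rewrite -ltNge => /ltr0_norm.
apply: (@le_trans _ _ (\sum_(i <- s)
    (`|complex.Re (u i)| + `|complex.Im (u i)|))).
  by apply: ler_sum => i _; exact: cmod_le_ReIm.
rewrite big_split /=; have -> : 4 * e = 2 * e + 2 * e by ring.
apply: lerD.
  exact: (part _ (fun P => Re_sum _ _ P u) le_Re_cmod).
exact: (part _ (fun P => Im_sum _ _ P u) le_Im_cmod).
Qed.

(** A sum over a set disjoint from [s0] is a difference of two sums over sets
    that contain [s0], both of which are close to the limit; [sum_cmod_le]
    then moves the modulus inside. *)
Lemma has_csum_tail (I : choiceType) (u : I -> R[i]) (l : R[i]) (e : R) :
  has_csum u l -> 0 < e ->
  exists s0 : seq I, [/\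
    forall s, uniq s -> {subset s0 <= s} -> cmod (\sum_(i <- s) u i - l) <= e &
    forall s, uniq s -> (forall i, i \in s -> i \notin s0) ->
      \sum_(i <- s) cmod (u i) <= e].
Proof.
(* A difference of two sums costs 2 (e / 8), and sum_cmod_le a factor 4. *)
move=> hu e0; have e8 : 0 < e / 8 by lra.
have [s0 hs0] := has_csum_finite_approx _ _ _ _ hu e8.
exists (undup s0); split=> [s us sub|s us dis].
  apply: le_trans (hs0 _ us _) _; last by lra.
  by move=> x xs; apply: sub; rewrite mem_undup.
have -> : e = 4 * (e / 8 + e / 8) by lra.
apply: sum_cmod_le => P.
have -> : \sum_(i <- s | P i) u i =
    (\sum_(i <- undup s0 ++ [seq i <- s | P i]) u i - l)
    - (\sum_(i <- undup s0) u i - l).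
  rewrite big_cat /= big_filter; ring.
apply: le_trans (cmodB _ _) _; apply: lerD; apply: hs0.
- rewrite cat_uniq undup_uniq filter_uniq //= andbT.
  apply/hasPn => x; rewrite mem_filter => /andP[_ /dis]; exact.
- by move=> x xs; rewrite mem_cat mem_undup xs.
- exact: undup_uniq.
- by move=> x xs; rewrite mem_undup.
Qed.

Lemma has_csum_bounded (I : choiceType) (u : I -> R[i]) (l : R[i]) :
  has_csum u l ->
  exists2 C : R, 0 <= C & forall s, uniq s -> \sum_(i <- s) cmod (u i) <= C.
Proof.
move=> hu; have [s0 [_ tail]] := has_csum_tail _ _ _ 1 hu ltr01.
exists (\sum_(i <- undup s0) cmod (u i) + 1) => [|s us].
  by rewrite addr_ge0 // sumr_ge0 // => i _; exact: cmod_ge0.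
rewrite (bigID (mem s0)) /=; apply: lerD.
  rewrite -big_filter; apply: sum_sub_le => [|||i]; rewrite ?filter_uniq //.
  - exact: undup_uniq.
  - by move=> i; rewrite mem_filter mem_undup => /andP[].
  - exact: cmod_ge0.
rewrite -big_filter; apply: tail; first exact: filter_uniq.
by move=> i; rewrite mem_filter => /andP[].
Qed.

End Unconditional.

Section IntFamilies.
Context {R : realType}.

Lemma has_csum_int_tail (u : int -> R[i]) (l : R[i]) (e : R) :
  has_csum u l -> 0 < e ->
  exists L0 : nat, forall L, (L0 <= L)%N ->
    (forall s : seq int, uniq s -> (forall z, (absz z <= L)%N -> z \in s) ->
       cmod (\sum_(i <- s) u i - l) <= e) /\
    (forall s : seq int, uniq s -> (forall z, z \in s -> (L < absz z)%N) ->
       \sum_(i <- s) cmod (u i) <= e).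
Proof.
move=> hu e0; have [s0 [app tail]] := has_csum_tail _ _ _ _ hu e0.
have [L0 hL0] : exists L0, forall z : int, z \in s0 -> (absz z <= L0)%N.
  exists (\max_(z <- s0) absz z) => z zs.
  by rewrite (big_rem z zs) /= leq_maxl.
exists L0 => L LL; split=> s us h; [apply: app|apply: tail] => // z zs.
  by apply: h; apply: leq_trans LL; exact: hL0.
by apply/negP => /hL0 zL; have := h _ zs; rewrite ltnNge (leq_trans zL).
Qed.

End IntFamilies.

(** * A nearly degenerate combination of translates *)

(** The Gaussian rationals: coefficients from a countable set are needed to
    cover a period by countably many sets. *)
Definition cratr {R : realType} (a : rat * rat) : R[i] :=
  (ratr a.1 +i* ratr a.2)%C.

Lemma finite_family_bound {R : realType} (I : finType) (P : I -> R -> Prop) :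
  (forall i x y, x <= y -> P i x -> P i y) ->
  (forall i, exists2 C : R, 0 <= C & P i C) ->
  exists2 C : R, 0 <= C & forall i, P i C.
Proof.
move=> mono /(_ _)/cid2 h; exists (\sum_i s2val (h i)) => [|i].
  by apply: sumr_ge0 => i _; case: (h i).
apply: mono (s2valP' (h i)); rewrite (bigD1 i) //= lerDl.
by apply: sumr_ge0 => k _; case: (h k).
Qed.

Lemma finite_family_threshold (I : finType) (P : I -> nat -> Prop) :
  (forall i, exists L0 : nat, forall L, (L0 <= L)%N -> P i L) ->
  exists L, forall i, P i L.
Proof.
move=> /(_ _)/cid h; exists (\max_i sval (h i)) => i.
by apply: (svalP (h i)); exact: leq_bigmax.
Qed.

Section DegenerateCombination.
Context {R : realType}.
Context (g : R -> R[i]) (gpu : partition_of_unity g).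
Context (m r p : nat) (m0 : (0 < m)%N) (r0 : (0 < r)%N).
Context (mrp : ((r - 1) * m + 1 < p)%N).
Context (t : R).

Let p0 : (0 < p)%N. Proof. by apply: leq_ltn_trans mrp. Qed.
Let mN0 : m%:R != 0 :> R. Proof. by rewrite pnatr_eq0 -lt0n. Qed.

(** The points [t + s / beta - alpha k]. *)
Definition node (k s : nat) : R := t + s%:R * (r%:R / p%:R) - k%:R / m%:R.

(** The terms of the entry [(k, s)] of the coset-sum matrix. *)
Definition coset_sample (k s : nat) (i : int) : R[i] :=
  g (node k s + r%:R * i%:~R).

Definition int_sample (k s : nat) (z : int) : R[i] := g (node k s - z%:~R).

(** As [i'] runs over [0, ..., r - 1] and [i] over the integers, [i' - r i]
    takes every integer value once: the rows [k + m i'] share out the terms of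
    one partition of unity. *)
Lemma coset_sampleE k i' s i :
  coset_sample (k + m * i') s i = int_sample k s (i'%:Z - r%:Z * i).
Proof.
rewrite /coset_sample /int_sample /node; congr g.
rewrite rmorphB rmorphM /= natrD natrM !pmulrn; field.
by rewrite -?pmulrn mN0 pnatr_eq0 -lt0n.
Qed.

Lemma int_sample_csum k s : has_csum (int_sample k s) 1.
Proof. exact: gpu. Qed.

Let q := (r * m)%N.

Lemma divmod_index k : (k < q)%N ->
  exists k0 i' : nat, [/\ (k0 < m)%N, (i' < r)%N & k = (k0 + m * i')%N].
Proof.
move=> kq; exists (k %% m)%N, (k %/ m)%N; split.
- by rewrite ltn_mod.
- by rewrite ltn_divLR.
- by rewrite addnC mulnC -divn_eq.
Qed.

Lemma affine_inj (i' : nat) : injective (fun i : int => i'%:Z - r%:Z * i).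
Proof. by move=> i j /addrI /oppr_inj /mulfI; apply; lia. Qed.

Lemma coset_sample_bounded : exists2 C : R, 0 <= C &
  forall k s, (k < q)%N -> (s < p)%N -> forall l, uniq l ->
    \sum_(i <- l) cmod (coset_sample k s i) <= C.
Proof.
have [C C0 hC] : exists2 C : R, 0 <= C & forall ks : 'I_m * 'I_p,
    forall l, uniq l -> \sum_(i <- l) cmod (int_sample ks.1 ks.2 i) <= C.
  apply: finite_family_bound => [ks x y xy h l ul|ks].
    by apply: le_trans xy; exact: h.
  exact: has_csum_bounded (int_sample_csum _ _).
exists C => // k s /divmod_index[k0 [i' [k0m i'r ->]]] sp l ul.
under eq_bigr do rewrite coset_sampleE.
rewrite -(big_map (fun i : int => i'%:Z - r%:Z * i) xpredT
  (fun z => cmod (int_sample k0 s z))).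
apply: (hC (Ordinal k0m, Ordinal sp)); rewrite map_inj_uniq //; exact: affine_inj.
Qed.

Definition trunc_sum L k s : R[i] :=
  \sum_(i < (L * 2).+1) coset_sample k s (i%:Z - L%:Z).

(** The truncation at [L] keeps, over the [r] rows of a residue class, a set of
    integers that contains [[-L, L]], while the discarded terms have index
    larger than [L] in modulus; so one application of the tail estimate to each
    of the [m p] partitions of unity involved gives both claims. *)
Lemma coset_sample_tail (e : R) : 0 < e -> exists L : nat,
  (forall k s, (k < q)%N -> (s < p)%N -> forall l, uniq l ->
    all (fun i : int => (L < absz i)%N) l ->
    \sum_(i <- l) cmod (coset_sample k s i) <= e) /\
  (forall k s, (k < m)%N -> (s < p)%N ->
    cmod (\sum_(i' < r) trunc_sum L (k + m * i') s - 1) <= e).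
Proof.
move=> e0; have [L hL] := finite_family_threshold _ _
  (fun ks : 'I_m * 'I_p => has_csum_int_tail _ _ _ (int_sample_csum ks.1 ks.2) e0).
exists L; split=> [k s /divmod_index[k0 [i' [k0m i'r ->]]] sp l ul /allP ll|k s km sp].
  under eq_bigr do rewrite coset_sampleE.
  rewrite -(big_map (fun i : int => i'%:Z - r%:Z * i) xpredT
    (fun z => cmod (int_sample k0 s z))).
  apply: (proj2 (hL (Ordinal k0m, Ordinal sp))).
    by rewrite map_inj_uniq //; exact: affine_inj.
  by move=> _ /mapP[i /ll Li ->]; nia.
have := proj1 (hL (Ordinal km, Ordinal sp))
  [seq i'%:Z - r%:Z * (i%:Z - L%:Z) | i' <- index_iota 0 r,
     i <- index_iota 0 (L * 2).+1].
rewrite big_allpairs_dep big_mkord.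
under eq_bigr => i' _.
  rewrite big_mkord; under eq_bigr => i _ do rewrite -coset_sampleE.
  over.
apply.
  apply: allpairs_uniq; rewrite ?iota_uniq // => x y.
  move=> /allpairsP[[a b] [ha hb ->]] /allpairsP[[c d] [hc hd ->]].
  move: ha hb hc hd; rewrite !mem_index_iota /= => ha hb hc hd e1.
  have bd : b = d by nia.
  by move: e1; rewrite bd => e1; congr (_, _); lia.
move=> z zL; pose i' := absz (z %% r%:Z)%Z; pose i := absz (L%:Z - (z %/ r%:Z)%Z).
have rp : 0 < r%:Z by lia.
have rn : r%:Z != 0 by lia.
have := divz_eq z r%:Z; have := modz_ge0 z rn; have := ltz_pmod z rp => h1 h2 h3.
apply/allpairsP; exists (i', i); rewrite !mem_index_iota /= /i' /i; split; nia.
Qed.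


(** The system consists of the rows [m <= k < r m] and of the row of ones.  For
    [k < m] the [k]-th row acts on a solution as the sum of the rows of its
    residue class, which is the all-ones row up to [e]. *)
Lemma kernel_vector (L : nat) (e : R) : 0 <= e ->
  (forall k s, (k < m)%N -> (s < p)%N ->
    cmod (\sum_(i' < r) trunc_sum L (k + m * i') s - 1) <= e) ->
  exists d : 'I_p -> R[i], [/\ forall s, cmod (d s) <= 1,
    exists s, cmod (d s) = 1 &
    forall k, (k < q)%N -> cmod (\sum_s d s * trunc_sum L k s) <= p%:R * e].
Proof.
move=> e0 he; pose T (k : 'I_((r - 1) * m + 1)) (s : 'I_p) :=
  if (k < (r - 1) * m)%N then trunc_sum L (m + k) s else 1.
have [d0 [[s0 ds0] Td0]] := wide_system_kernel _ _ _ T mrp.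
(* Normalize the solution to have largest modulus 1. *)
pose sM := [arg max_(s > s0) cmod (d0 s)]%O.
have sMP s : cmod (d0 s) <= cmod (d0 sM).
  by rewrite /sM; case: arg_maxP => // i _ h; exact: h.
have M0 : 0 < cmod (d0 sM).
  rewrite (lt_le_trans _ (sMP s0)) // lt_neqAle cmod_ge0 andbT eq_sym.
  by apply: contra ds0 => /eqP/cmod_eq0 ->.
have Minv z : cmod (z / ((cmod (d0 sM))%:C)%C) = cmod z / cmod (d0 sM).
  rewrite cmodM /cmod ComplexField.Normc.normcV -/(cmod _) -/(cmod _).
  by rewrite cmod_real ger0_norm // ltW.
pose d s := d0 s / ((cmod (d0 sM))%:C)%C.
have Td k : \sum_s T k s * d s = 0.
  transitivity ((\sum_s T k s * d0 s) / ((cmod (d0 sM))%:C)%C).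
    by rewrite mulr_suml; apply: eq_bigr => s _; rewrite mulrA.
  by rewrite Td0 mul0r.
have d1 s : cmod (d s) <= 1 by rewrite Minv ler_pdivrMr // mul1r.
exists d; split => //; first by exists sM; rewrite Minv divff // gt_eqF.
have high k : (m <= k < q)%N -> \sum_s d s * trunc_sum L k s = 0.
  move=> /andP[mk kq].
  have kl : (k - m < (r - 1) * m + 1)%N by rewrite /q in kq; nia.
  rewrite -[RHS](Td (Ordinal kl)); apply: eq_bigr => s _.
  by rewrite /T /= ifT ?subnKC // 1?mulrC //; rewrite /q in kq; nia.
have sum0 : \sum_s d s = 0.
  have kl : ((r - 1) * m < (r - 1) * m + 1)%N by lia.
  by rewrite -[RHS](Td (Ordinal kl)); apply: eq_bigr => s _;
    rewrite /T /= ltnn mul1r.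
move=> k kq; have pe0 : 0 <= p%:R * e by rewrite mulr_ge0.
have [km|mk] := ltnP k m; last by rewrite high ?cmod0 // mk.
have -> : \sum_s d s * trunc_sum L k s =
    \sum_s d s * (\sum_(i' < r) trunc_sum L (k + m * i') s - 1).
  under [RHS]eq_bigr do rewrite mulrBr mulr1.
  rewrite sumrB sum0 subr0.
  under [RHS]eq_bigr do rewrite mulr_sumr.
  rewrite exchange_big /= (bigD1 (Ordinal r0)) //= muln0 addn0.
  rewrite [X in _ + X]big1 ?addr0 // => i; rewrite -val_eqE /= => i0.
  apply: high; have := ltn_ord i; rewrite /q; nia.
apply: le_trans (cmod_sum _ _ _ _) _.
apply: (@le_trans _ _ (\sum_(s < p) e)); last first.
  by rewrite sumr_const card_ord mulr_natl.
apply: ler_sum => s _; rewrite cmodM -[leRHS]mul1r.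
by apply: ler_pM; rewrite ?cmod_ge0 // he.
Qed.

(** The number [N] of periods is chosen last: the boundary term of
    [block_sums_le] depends on the truncation [L], hence on the accuracy, but
    not on [N]. *)
Lemma degenerate_combination (eta : R) : 0 < eta ->
  exists (N : nat) (D : {ffun 'I_p -> rat * rat}), [/\ (0 < N)%N,
    0 < \sum_s cmod (cratr (D s) : R[i]) ^+ 2 &
    forall K : seq int, uniq K ->
      \sum_(k <- K) cmod (\sum_(i < N) \sum_(s < p) cratr (D s) *
          g (t + s%:R * (r%:R / p%:R) + i%:R * r%:R - k%:~R / m%:R)) ^+ 2
        <= eta * (N%:R * \sum_s cmod (cratr (D s) : R[i]) ^+ 2)].
Proof.
move=> eta0; have [C C0 hC] := coset_sample_bounded.
have q0 : 0 < q%:R :> R by rewrite ltr0n muln_gt0 r0.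
have pR0 : 0 < p%:R :> R by rewrite ltr0n.
(* block_sums_le costs 10 dl^2 per period for each of the q residue classes;
   this must stay below eta / 8, because the sum of the squared coefficients
   is only known to be at least 1 / 4. *)
pose dl := Num.min 1 (eta / (80 * q%:R)).
have dl0 : 0 < dl by rewrite lt_min ltr01 divr_gt0 // mulr_gt0.
have dlq : 10 * q%:R * dl ^+ 2 <= eta / 8.
  have h1 : dl <= 1 by rewrite ge_min lexx.
  have h2 : dl <= eta / (80 * q%:R) by rewrite ge_min lexx orbT.
  have h3 : dl ^+ 2 <= eta / (80 * q%:R).
    by apply: le_trans h2; rewrite expr2 ler_piMl // ltW.
  have -> : eta / 8 = 10 * q%:R * (eta / (80 * q%:R)) by field; rewrite gt_eqF.
  by rewrite ler_wpM2l // mulr_ge0 // ltW.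
pose e := Num.min (1 / 2) (dl / (p%:R * (2 + C))).
have e0 : 0 < e by rewrite lt_min divr_gt0 //= divr_gt0 // mulr_gt0 // ltr_wpDr.
have e2 : e <= 1 / 2 by rewrite ge_min lexx.
have ep : p%:R * e * (2 + C) <= dl.
  have h : e <= dl / (p%:R * (2 + C)) by rewrite ge_min lexx orbT.
  move: h; rewrite ler_pdivlMr; last by rewrite mulr_gt0 // ltr_wpDr.
  by move=> h; apply: le_trans h; apply: le_of_eq; ring.
have [L [tail PU]] := coset_sample_tail _ e0.
have [d [d1 [s0 ds0] dT]] := kernel_vector _ _ (ltW e0) PU.
have /fin_all_exists[D0 hD0] s := cmod_rat_approx (d s) _ e0.
pose D : {ffun 'I_p -> rat * rat} := [ffun s => D0 s].
have hD s : cmod (d s - cratr (D s)) <= e by rewrite ffunE; exact: hD0.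
have D2 s : cmod (cratr (D s) : R[i]) <= 2.
  have -> : cratr (D s) = d s - (d s - cratr (D s)) by ring.
  by apply: le_trans (cmodB _ _) _; have := hD s; have := d1 s; lra.
pose S : R := \sum_s cmod (cratr (D s) : R[i]) ^+ 2.
have S4 : 1 / 4 <= S.
  have h : 1 / 2 <= cmod (cratr (D s0) : R[i]).
    have := cmodD (d s0 - cratr (D s0)) (cratr (D s0)).
    by rewrite subrK ds0; have := hD s0; lra.
  apply: (@le_trans _ _ (cmod (cratr (D s0) : R[i]) ^+ 2)).
    have -> : (1 / 4 : R) = (1 / 2) ^+ 2 by field.
    by rewrite ler_pXn2r ?nnegrE ?cmod_ge0.
  by rewrite /S (bigD1 s0) //= lerDl sumr_ge0 // => s _; rewrite sqr_ge0.
pose a k i := \sum_(s < p) cratr (D s) * coset_sample k s i.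
have apos (B : R) k (l : seq int) : 0 <= B ->
    (forall s : 'I_p, \sum_(i <- l) cmod (coset_sample k s i) <= B) ->
    \sum_(i <- l) cmod (a k i) <= 2 * p%:R * B.
  move=> B0 h; apply: (@le_trans _ _
    (\sum_(i <- l) \sum_(s < p) 2 * cmod (coset_sample k s i))).
    apply: ler_sum => i _; apply: le_trans (cmod_sum _ _ _ _) _.
    by apply: ler_sum => s _; rewrite cmodM ler_wpM2r ?cmod_ge0.
  rewrite exchange_big /=; apply: (@le_trans _ _ (\sum_(s < p) 2 * B)).
    by apply: ler_sum => s _; rewrite -mulr_sumr ler_wpM2l.
  by rewrite sumr_const card_ord -mulr_natl; apply: le_of_eq; ring.
have pe0 : 0 <= p%:R * e by rewrite mulr_ge0 // ltW.
have block k (N : nat) (l : seq int) : (k < q)%N -> uniq l ->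
    \sum_(u <- l) cmod (\sum_(i < N) a k (i%:Z - u)) ^+ 2
      <= 10 * dl ^+ 2 * N%:R + 4 * L%:R * (2 * p%:R * C) ^+ 2.
  move=> kq ul; apply: block_sums_le => //; first exact: ltW.
  - by rewrite !mulr_ge0 // ltW.
  - by move=> l' ul'; apply: apos => // s; apply: hC.
  - move=> l' ul' ll'; apply: (@le_trans _ _ (2 * p%:R * e)).
      by apply: apos => [|s]; [exact: ltW|exact: tail].
    apply: le_trans ep; rewrite mulrDr.
    rewrite -[leLHS]addr0; apply: lerD; last by rewrite mulr_ge0.
    by apply: le_of_eq; ring.
  have -> : \sum_(i < (L * 2).+1) a k (i%:Z - L%:Z) =
      \sum_s d s * trunc_sum L k s - \sum_s (d s - cratr (D s)) * trunc_sum L k s.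
    rewrite -sumrB exchange_big /=; apply: eq_bigr => s _.
    by rewrite -mulr_sumr -/(trunc_sum L k s); ring.
  apply: le_trans (cmodB _ _) _.
  apply: (@le_trans _ _ (p%:R * e + p%:R * (e * C))); last first.
    apply: le_trans ep; have -> : p%:R * e * (2 + C) =
       p%:R * e + p%:R * (e * C) + p%:R * e by ring.
    by rewrite lerDl.
  apply: lerD; first exact: dT.
  apply: le_trans (cmod_sum _ _ _ _) _.
  apply: (@le_trans _ _ (\sum_(s < p) e * C)); last first.
    by rewrite sumr_const card_ord mulr_natl.
  apply: ler_sum => s _; rewrite cmodM; apply: ler_pM; rewrite ?cmod_ge0 //.
  apply: le_trans (cmod_sum _ _ _ _) _.
  rewrite -(big_mkord xpredT (fun i => cmod (coset_sample k s (i%:Z - L%:Z)))).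
  rewrite -(big_map (fun i : nat => i%:Z - L%:Z) xpredT
    (fun j => cmod (coset_sample k s j))).
  apply: hC => //; rewrite map_inj_uniq ?iota_uniq //.
  by move=> i j /addIr [].
pose Q : R := q%:R * (4 * L%:R * (2 * p%:R * C) ^+ 2).
have Q0 : 0 <= Q by rewrite !mulr_ge0 ?sqr_ge0 // ltW.
have [N N0 NQ] : exists2 N : nat, (0 < N)%N & Q <= eta / 8 * N%:R.
  have x0 : 0 <= 8 * Q / eta by rewrite divr_ge0 ?mulr_ge0 // ltW.
  have := archi_boundP x0; rewrite ltr_pdivrMr //.
  set n := Num.bound _ => h; exists n.+1 => //.
  by rewrite -(natr1 n); move: h; clearbody Q; set x := n%:R; lra.
exists N, D; split => //; first by apply: lt_le_trans S4; lra.
move=> K uK; rewrite -/S.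
have qn : (0 < q)%N by rewrite muln_gt0 r0.
have zq : q%:Z != 0 by rewrite eqz_nat -lt0n.
have FE (k : int) : \sum_(i < N) \sum_(s < p) cratr (D s) *
      g (t + s%:R * (r%:R / p%:R) + i%:R * r%:R - k%:~R / m%:R) =
    \sum_(i < N) a (absz (k %% q%:Z)%Z) (i%:Z - (k %/ q%:Z)%Z).
  apply: eq_bigr => i _; apply: eq_bigr => s _; congr (_ * g _).
  rewrite /node {1}(divz_eq k q%:Z) -{1}(gez0_abs (modz_ge0 k zq)).
  rewrite rmorphB rmorphD rmorphM /= -!pmulrn natrM.
  by field; rewrite mN0 pnatr_eq0 -lt0n.
under eq_bigr => k _ do rewrite FE.
pose F k0 (u : int) := cmod (\sum_(i < N) a k0 (i%:Z - u)) ^+ 2.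
have part : \sum_(k <- K) F (absz (k %% q%:Z)%Z) (k %/ q%:Z)%Z =
    \sum_(k0 < q) \sum_(k <- K | absz (k %% q%:Z)%Z == k0) F k0 (k %/ q%:Z)%Z.
  under [RHS]eq_bigr do rewrite big_mkcond.
  rewrite exchange_big /=; apply: eq_bigr => k _.
  have kq : (absz (k %% q%:Z)%Z < q)%N.
    have /(ltz_pmod k) : 0 < q%:Z by [].
    by have := modz_ge0 k zq; case: (k %% q%:Z)%Z.
  rewrite (bigD1 (Ordinal kq)) //= eqxx big1 ?addr0 // => i.
  by rewrite -val_eqE /= eq_sym => /negbTE ->.
rewrite [leLHS]part.
apply: (@le_trans _ _ (\sum_(k0 < q)
    (10 * dl ^+ 2 * N%:R + 4 * L%:R * (2 * p%:R * C) ^+ 2))).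
  apply: ler_sum => k0 _; rewrite -big_filter.
  rewrite -(big_map (fun k : int => (k %/ q%:Z)%Z) xpredT (F k0)).
  apply: block => //; rewrite map_inj_in_uniq ?filter_uniq // => x y.
  rewrite !mem_filter => /andP[/eqP hx _] /andP[/eqP hy _] hxy.
  rewrite (divz_eq x q%:Z) (divz_eq y q%:Z) hxy; congr (_ + _).
  by rewrite -(gez0_abs (modz_ge0 x zq)) -(gez0_abs (modz_ge0 y zq)) hx hy.
rewrite sumr_const card_ord -[leLHS]mulr_natl mulrDr -/Q.
have -> : q%:R * (10 * dl ^+ 2 * N%:R) = (10 * q%:R * dl ^+ 2) * N%:R by ring.
apply: (@le_trans _ _ (eta / 8 * N%:R + eta / 8 * N%:R)).
  by apply: lerD => //; rewrite ler_wpM2r.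
have -> : eta / 8 * N%:R + eta / 8 * N%:R = eta * (N%:R * (1 / 4)) by field.
by rewrite ler_wpM2l ?(ltW eta0) // ler_wpM2l.
Qed.

End DegenerateCombination.

(** * Integrals of complex functions *)
Section LocallyBounded.
Context {R : realType}.
Implicit Types f g : R -> R[i].

(** A class of functions that is stable under all the operations used below and
    whose members become integrable when multiplied by the indicator function
    of a bounded set. *)
Definition locally_bounded f :=
  @cmeasurable_fun R _ (measurableTypeR R) f /\
  forall M : R, exists B, forall t, `|t| <= M -> cmod (f t) <= B.

Definition cintegrable f :=
  (@lebesgue_measure R).-integrable setT (EFin \o (fun t => complex.Re (f t))) /\
  (@lebesgue_measure R).-integrable setT (EFin \o (fun t => complex.Im (f t))).

Definition cint f : R[i] := cintegral (@lebesgue_measure R) f.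

Lemma complexReD (z w : R[i]) : complex.Re (z + w) = complex.Re z + complex.Re w.
Proof. by case: z; case: w. Qed.

Lemma complexImD (z w : R[i]) : complex.Im (z + w) = complex.Im z + complex.Im w.
Proof. by case: z; case: w. Qed.

Lemma complexReM (z w : R[i]) :
  complex.Re (z * w) = complex.Re z * complex.Re w - complex.Im z * complex.Im w.
Proof. by case: z; case: w. Qed.

Lemma complexImM (z w : R[i]) :
  complex.Im (z * w) = complex.Re z * complex.Im w + complex.Im z * complex.Re w.
Proof. by case: z => a b; case: w. Qed.

Lemma locb_cst c : locally_bounded (fun=> c).
Proof.
split; first by split; exact: measurable_cst.
by move=> M; exists (cmod c).
Qed.

Lemma locbD f g : locally_bounded f -> locally_bounded g ->
  locally_bounded (fun t => f t + g t).
Proof.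
move=> [[rf jf] bf] [[rg jg] bg]; split.
  split.
    by under eq_fun do rewrite complexReD; exact: measurable_funD.
  by under eq_fun do rewrite complexImD; exact: measurable_funD.
move=> M; have [B hB] := bf M; have [B' hB'] := bg M; exists (B + B') => t tM.
by apply: le_trans (cmodD _ _) _; apply: lerD; [exact: hB|exact: hB'].
Qed.

Lemma locbM f g : locally_bounded f -> locally_bounded g ->
  locally_bounded (fun t => f t * g t).
Proof.
move=> [[rf jf] bf] [[rg jg] bg]; split.
  split.
    under eq_fun do rewrite complexReM.
    by apply: measurable_funB; exact: measurable_funM.
  under eq_fun do rewrite complexImM.
  by apply: measurable_funD; exact: measurable_funM.
move=> M; have [B hB] := bf M; have [B' hB'] := bg M; exists (B * B') => t tM.
by rewrite cmodM ler_pM ?cmod_ge0 //; [exact: hB|exact: hB'].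
Qed.

Lemma locb_conj f : locally_bounded f -> locally_bounded (fun t => (f t)^*%C).
Proof.
move=> [[rf jf] bf]; split; last first.
  by move=> M; have [B hB] := bf M; exists B => t tM; rewrite cmod_conj hB.
split.
  rewrite (_ : (fun _ => _) = (fun t => complex.Re (f t))) //.
  by apply/funext => t; case: (f t).
rewrite (_ : (fun _ => _) = (fun t => - complex.Im (f t))); last first.
  by apply/funext => t; case: (f t).
exact: measurableT_comp.
Qed.

Lemma locb_sum (I : Type) (s : seq I) (F : I -> R -> R[i]) :
  (forall i, locally_bounded (F i)) ->
  locally_bounded (fun t => \sum_(i <- s) F i t).
Proof.
move=> h; elim: s => [|i s IH].
  by under eq_fun do rewrite big_nil; exact: locb_cst.
by under eq_fun do rewrite big_cons; exact: locbD.
Qed.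

Lemma measurable_shift (a : R) : measurable_fun setT
  (fun t : measurableTypeR R => t + a : measurableTypeR R).
Proof. by apply: measurable_funD => //; exact: measurable_cst. Qed.

Lemma locb_shift f (a : R) : locally_bounded f ->
  locally_bounded (fun t => f (t + a)).
Proof.
move=> [[rf jf] bf]; split.
  have ms := measurable_shift a.
  split.
    exact: (measurableT_comp rf ms).
  exact: (measurableT_comp jf ms).
move=> M; have [B hB] := bf (M + `|a|); exists B => t tM; apply: hB.
by apply: le_trans (ler_normD _ _) _; rewrite lerD2r.
Qed.

Lemma locb_indic (E : set (measurableTypeR R)) : measurable E ->
  locally_bounded (fun t => ((\1_E t : R)%:C)%C).
Proof.
move=> mE; split; last first.
  move=> M; exists 1 => t _; rewrite cmod_real indicE.
  by case: (_ \in _); rewrite ?normr1 ?normr0.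
split; first exact: measurable_indic.
exact: measurable_cst.
Qed.

Lemma continuous_locb f : continuous (f : R -> R[i]^o) -> locally_bounded f.
Proof.
move=> cf.
have cont (h : R[i] -> R) : (forall z w, `|h z - h w| <= cmod (z - w)) ->
    continuous (h \o f : R -> R).
  move=> hle x; apply/(@cvgrPdist_lt R R) => e e0.
  have e0C : (0 : R[i]) < (e%:C)%C by rewrite ltcR.
  have near_x : \forall t \near x, `|(f x : R[i]^o) - f t| < (e%:C)%C.
    exact: (proj1 (@cvgrPdist_lt R[i] (R[i]^o) _ _ _ f (f x)) (cf x) _ e0C).
  move: near_x; apply: filterS => t; rewrite normc_def ltcR /= => ht.
  apply: le_lt_trans (hle _ _) _; move: ht.
  by rewrite /cmod; case: (f x - f t).
have cR : continuous ((@complex.Re R) \o f : R -> R).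
  apply: cont => z w; apply: le_trans (le_Re_cmod _).
  by rewrite complexReD; case: w.
have cI : continuous ((@complex.Im R) \o f : R -> R).
  apply: cont => z w; apply: le_trans (le_Im_cmod _).
  by rewrite complexImD; case: w.
split; first by split; exact: continuous_measurable_fun.
have bnd (h : R -> R) : continuous h ->
    forall M, exists B, forall t, `|t| <= M -> `|h t| <= B.
  move=> ch M; have [M0|M0] := leP 0 M; last first.
    exists 0 => t tM.
    by have := lt_le_trans M0 (le_trans (normr_ge0 t) tM); rewrite ltxx.
  have [||c _ hc] := @EVT_max R (fun t => `|h t|) (- M) M.
  - by rewrite ge0_cp.
  - apply: continuous_subspaceT => x.
    by apply: continuous_comp; [exact: ch|exact: norm_continuous].
  by exists `|h c| => t tM; apply: hc; rewrite in_itv /= -ler_norml.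
move=> M; have [B hB] := bnd _ cR M; have [B' hB'] := bnd _ cI M.
exists (B + B') => t tM; apply: le_trans (cmod_le_ReIm _) _.
by apply: lerD; [exact: hB|exact: hB'].
Qed.

Lemma locb_integrable f (M : R) : locally_bounded f ->
  (forall t, M < `|t| -> f t = 0) ->
  cintegrable f.
Proof.
move=> [[rf jf] bf] f0; have [B hB] := bf M.
have I := integrable_indic_itv (- M) M true false.
have B0 : 0 <= `|B| by [].
have main (h : R -> R) : measurable_fun (setT : set (measurableTypeR R)) h ->
    (forall t, `|h t| <= cmod (f t)) ->
    (@lebesgue_measure R).-integrable setT (EFin \o h).
  move=> mh hf.
  have := @integrableZl _ _ _ (@lebesgue_measure R) setT measurableT `|B| _ I.
  apply: (le_integrable measurableT).
  - exact/measurable_EFinP.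
  - move=> t _; rewrite /= lee_fin; apply: le_trans (hf t) _.
    rewrite normrM normr_id indicE; have [tM|tM] := leP `|t| M.
      rewrite mem_set /= ?in_itv /= -?ler_norml // normr1 mulr1.
      by apply: le_trans (hB _ tM) _; exact: ler_norm.
    by rewrite f0 // cmod0 mulr_ge0.
by split; apply: main => // t; [exact: le_Re_cmod|exact: le_Im_cmod].
Qed.

Lemma cintegrableD f g : cintegrable f -> cintegrable g ->
  cintegrable (fun t => f t + g t).
Proof.
move=> [rf jf] [rg jg]; split.
  under eq_fun do rewrite complexReD; exact: (integrableD measurableT rf rg).
under eq_fun do rewrite complexImD; exact: (integrableD measurableT jf jg).
Qed.

Lemma cintD f g : cintegrable f -> cintegrable g ->
  cint (fun t => f t + g t) = cint f + cint g.
Proof.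
move=> [rf jf] [rg jg]; rewrite /cint /cintegral.
apply/eqP; rewrite eq_complex /=; apply/andP; split; apply/eqP.
  by under eq_fun do rewrite complexReD; rewrite RintegralD.
by under eq_fun do rewrite complexImD; rewrite RintegralD.
Qed.

Lemma cint_sum (I : Type) (s : seq I) (F : I -> R -> R[i]) :
  (forall i, cintegrable (F i)) ->
  cint (fun t => \sum_(i <- s) F i t) = \sum_(i <- s) cint (F i) /\
  cintegrable (fun t => \sum_(i <- s) F i t).
Proof.
move=> h; elim: s => [|i s [IH1 IH2]].
  under eq_fun do rewrite big_nil.
  rewrite big_nil; split; last first.
    by split; exact: integrable0.
  rewrite /cint /cintegral /=; apply/eqP.
  by rewrite eq_complex /= !Rintegral_cst //= !mul0r eqxx.
under eq_fun do rewrite big_cons.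
rewrite big_cons -IH1 -cintD //; split => //; exact: cintegrableD.
Qed.

Lemma cintZ (c : R[i]) f : cintegrable f ->
  cint (fun t => c * f t) = c * cint f.
Proof.
case: c => a b [rf jf]; rewrite /cint /cintegral.
have rZ (k : R) := @RintegralZl _ _ _ (@lebesgue_measure R) setT _ k measurableT rf.
have jZ (k : R) := @RintegralZl _ _ _ (@lebesgue_measure R) setT _ k measurableT jf.
have irZ (k : R) := @integrableZl _ _ _ (@lebesgue_measure R) setT measurableT k _ rf.
have ijZ (k : R) := @integrableZl _ _ _ (@lebesgue_measure R) setT measurableT k _ jf.
apply/eqP; rewrite eq_complex /=; apply/andP; split; apply/eqP.
  under eq_fun do rewrite complexReM /=.
  rewrite RintegralB ?rZ ?jZ //; [exact: irZ|exact: ijZ].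
under eq_fun do rewrite complexImM /=.
rewrite RintegralD ?rZ ?jZ //; [exact: ijZ|exact: irZ].
Qed.

Lemma cint_conj f : cintegrable f -> cint (fun t => (f t)^*%C) = (cint f)^*%C.
Proof.
move=> [rf jf]; rewrite /cint /cintegral /=.
apply/eqP; rewrite eq_complex /=; apply/andP; split; apply/eqP.
  by congr Rintegral; apply/funext => t; case: (f t).
rewrite (_ : (fun _ => _) = (fun t => (-1) * complex.Im (f t))); last first.
  by apply/funext => t; case: (f t) => x y /=; rewrite mulN1r.
by rewrite RintegralZl // mulN1r.
Qed.

Lemma lebesgue_measure_shift (a : R) (A : set (measurableTypeR R)) :
  measurable A ->
  pushforward (@lebesgue_measure R)
    (fun t : measurableTypeR R => t + a : measurableTypeR R) A
  = lebesgue_measure A.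
Proof.
move=> mA.
have ms := measurable_shift a.
apply/esym/lebesgue_measure_unique => //= _ [[x y]] _ <-.
have -> : pushforward lebesgue_measure
      (fun t : measurableTypeR R => t + a : measurableTypeR R)
      `](x, y).1, (x, y).2]%classic
    = lebesgue_measure `]x - a, y - a]%classic.
  rewrite /pushforward; congr (lebesgue_measure _); apply/seteqP.
  by split=> t /=; rewrite !in_itv /= ltrBlDr lerBrDr.
rewrite !lebesgue_measure_itv /= !lte_fin ltrD2r -!EFinB. 
by have -> : y - a - (x - a) = y - x by ring.
Qed.

Lemma cint_shift f (a : R) : locally_bounded f -> cintegrable f ->
  cintegrable (fun t => f (t + a)) -> cint (fun t => f (t + a)) = cint f.
Proof.
move=> [[mr mj] _] [rf jf] [rfa jfa].
have ms := measurable_shift a.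
have main (h : R -> R) : measurable_fun (setT : set (measurableTypeR R)) h ->
    (@lebesgue_measure R).-integrable setT (EFin \o (fun t => h (t + a))) ->
    Rintegral (@lebesgue_measure R) setT (fun t => h (t + a)) =
    Rintegral (@lebesgue_measure R) setT h.
  move=> mh hi; rewrite /Rintegral; congr fine.
  have mh' : measurable_fun (setT : set (measurableTypeR R)) (EFin \o h).
    exact/measurable_EFinP.
  have := integral_pushforward ms mh' hi measurableT.
  rewrite preimage_setT /= => <-.
  apply: eq_measure_integral => // A mA _; exact: lebesgue_measure_shift.
rewrite /cint /cintegral; congr Complex.
  exact: (main (fun t => complex.Re (f t))).
exact: (main (fun t => complex.Im (f t))).
Qed.

End LocallyBounded.

(** * Bessel's inequality on one period *)
Section Bessel.
Context {R : realType}.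
Implicit Types f h : R -> R[i].

Lemma cexpiD (a b : R) : cexpi (a + b) = cexpi a * cexpi b.
Proof.
rewrite /cexpi; apply/eqP; rewrite eq_complex /= cosD sinD eqxx /=.
by rewrite addrC [sin a * _]mulrC [cos b * _]mulrC mulrC addrC; apply/eqP; ring.
Qed.

Lemma cexpi_conj (a : R) : (cexpi a)^*%C = cexpi (- a).
Proof. by rewrite /cexpi cosN sinN. Qed.

Lemma cmod_cexpi (a : R) : cmod (cexpi a) = 1.
Proof. by rewrite /cmod /= addrC sin2cos2 subrK sqrtr1. Qed.

Lemma cexpi_2pi (n : int) : cexpi (2 * pi * n%:~R : R) = 1.
Proof.
have node (k : nat) : cexpi (2 * pi * k%:R : R) = 1.
  have -> : 2 * pi * k%:R = 0 + (pi *+ 2) *+ k :> R.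
    by rewrite add0r -[RHS]mulr_natr -[pi *+ 2]mulr_natl.
  rewrite /cexpi (periodicn (@cosD2pi R)) (periodicn (@sinD2pi R)).
  by rewrite cos0 sin0.
case: n => k; first by rewrite -pmulrn node.
rewrite NegzE mulrNz -pmulrn mulrN -cexpi_conj node; exact: conjc1.
Qed.

Lemma locb_cexpi (w : R) : locally_bounded (fun t => cexpi (w * t)).
Proof.
have cw : continuous (fun t : R => w * t) by apply: mulrl_continuous.
split; last by move=> M; exists 1 => t _; rewrite cmod_cexpi.
split; apply: continuous_measurable_fun => x.
  by apply: continuous_comp; [exact: cw|exact: continuous_cos].
by apply: continuous_comp; [exact: cw|exact: continuous_sin].
Qed.

Lemma Rintegral_derive (F h : R -> R) (T : R) : 0 < T ->
  (forall x : R, is_derive x 1 F (h x)) -> continuous h ->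
  Rintegral (@lebesgue_measure R) setT (fun t => \1_(`[0, T[%classic) t * h t)
  = F T - F 0.
Proof.
move=> T0 dF ch.
have cF : continuous F.
  move=> x; apply: differentiable_continuous; apply/derivable1_diffP.
  by case: (dF x).
have -> : (fun t => \1_(`[0, T[%classic) t * h t) = h \_ (`[0, T[%classic).
  apply/funext => t; rewrite patchE indicE.
  by case: (t \in _); rewrite ?mul1r ?mul0r.
rewrite -Rintegral_mkcond Rintegral_itv_bndo_bndc; last first.
  apply: (@integrableS _ _ _ _ (`[0, T]%classic : set (measurableTypeR R))) => //.
    by move=> x /=; rewrite !in_itv /= => /andP[-> /ltW ->].
  apply: continuous_compact_integrable; first exact: segment_compact.
  exact: continuous_subspaceT.
rewrite /Rintegral (@continuous_FTC2 _ h F) //.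
- exact: continuous_subspaceT.
- split.
  + by move=> x _; case: (dF x).
  + by apply/cvg_at_right_filter; exact: cF.
  + by apply/cvg_at_left_filter; exact: cF.
by move=> x _; rewrite derive1E; case: (dF x).
Qed.

Context (T : R) (T0 : 0 < T).

Definition box (t : R) : R[i] := ((\1_(`[0, T[%classic) t : R)%:C)%C.

Definition expo (l : int) (t : R) : R[i] := cexpi (2 * pi * T^-1 * l%:~R * t).

Lemma locb_box : locally_bounded box.
Proof. exact: locb_indic. Qed.

Lemma box_conj t : (box t)^*%C = box t.
Proof. exact: conjc_real. Qed.

Lemma box_integrable f : locally_bounded f -> cintegrable (fun t => box t * f t).
Proof.
move=> lf; apply: (@locb_integrable _ _ T); first exact: locbM locb_box lf.
move=> t tT; rewrite /box indicE memNset ?mul0r //= in_itv /=.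
by move=> /andP[t0 tT1]; move: tT; rewrite ger0_norm // ltNge ltW.
Qed.

Lemma expo_orthogonal (n : int) :
  cint (fun t => box t * expo n t) = if n == 0 then (T%:C)%C else 0.
Proof.
pose w : R := 2 * pi * T^-1 * n%:~R.
have wT : w * T = 2 * pi * n%:~R by rewrite /w; field; rewrite gt_eqF.
have cw : continuous (fun t : R => w * t) by apply: mulrl_continuous.
have -> : cint (fun t => box t * expo n t) =
  (Rintegral (@lebesgue_measure R) setT
     (fun t => \1_(`[0, T[%classic) t * cos (w * t))
   +i* Rintegral (@lebesgue_measure R) setT
     (fun t => \1_(`[0, T[%classic) t * sin (w * t)))%C.
  rewrite /cint /cintegral; congr Complex; congr Rintegral; apply/funext => t.
    by rewrite complexReM /= mul0r subr0.
  by rewrite complexImM /= mul0r addr0.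
have ccos : continuous (fun t => cos (w * t)).
  by move=> x; apply: continuous_comp; [exact: cw|exact: continuous_cos].
have csin : continuous (fun t => sin (w * t)).
  by move=> x; apply: continuous_comp; [exact: cw|exact: continuous_sin].
have [n0|n0] := eqVneq n 0.
  have w0 : w = 0 by rewrite /w n0 mulr0.
  have dC (x : R) : is_derive x 1 (id : R -> R) (cos (w * x)).
    by rewrite w0 mul0r cos0; exact: is_derive_id.
  have dS (x : R) : is_derive x 1 (cst 0 : R -> R) (sin (w * x)).
    by rewrite w0 mul0r sin0; exact: is_derive_cst.
  rewrite (@Rintegral_derive _ _ _ T0 dC ccos).
  rewrite (@Rintegral_derive _ _ _ T0 dS csin).
  by rewrite subr0 /= subrr.
have w0 : w != 0.
  rewrite /w !mulf_neq0 ?invr_neq0 ?intr_eq0 //; first by rewrite gt_eqF // pi_gt0.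
  by rewrite gt_eqF.
have [cT sT] : cos (w * T) = 1 /\ sin (w * T) = 0.
  by have := cexpi_2pi n; rewrite -wT /cexpi => -[-> ->].
have dC (x : R) : is_derive x 1 (fun t => w^-1 * sin (w * t)) (cos (w * x)).
  apply: is_derive_eq; rewrite /GRing.scale /= ?mulr1.
  by field.
have dS (x : R) : is_derive x 1 (fun t => - (w^-1 * cos (w * t))) (sin (w * x)).
  apply: is_derive_eq; rewrite /GRing.scale /= ?mulr1.
  by field.
rewrite (@Rintegral_derive _ _ _ T0 dC ccos).
rewrite (@Rintegral_derive _ _ _ T0 dS csin).
by rewrite cT sT !mulr0 cos0 sin0 mulr0 !subrr.
Qed.

(** The inner product of [L^2] of the interval [[0, T[], extended to functions
    on the line. *)
Definition box_inner f h : R[i] := cint (fun t => box t * (f t * (h t)^*%C)).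

Lemma box_inner_integrable f h : locally_bounded f -> locally_bounded h ->
  cintegrable (fun t => box t * (f t * (h t)^*%C)).
Proof. by move=> lf lh; apply/box_integrable/locbM => //; exact: locb_conj. Qed.

Lemma locb_expo l : locally_bounded (expo l).
Proof. exact: locb_cexpi. Qed.

Lemma box_inner_conj f h : locally_bounded f -> locally_bounded h ->
  box_inner h f = (box_inner f h)^*%C.
Proof.
move=> lf lh; rewrite -cint_conj; last exact: box_inner_integrable.
congr cint; apply/funext => t.
by rewrite !conjc_mul box_conj conjcK [_^*%C * _]mulrC.
Qed.

Lemma locbZ (c : R[i]) f : locally_bounded f ->
  locally_bounded (fun t => c * f t).
Proof. by apply: locbM; exact: locb_cst. Qed.

Lemma box_innerBZl f h k (c : R[i]) :
  locally_bounded f -> locally_bounded h -> locally_bounded k ->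
  box_inner (fun t => f t - c * h t) k = box_inner f k - c * box_inner h k.
Proof.
move=> lf lh lk.
have -> : box_inner (fun t => f t - c * h t) k =
    cint (fun t => box t * (f t * (k t)^*%C) +
                   (- c) * (box t * (h t * (k t)^*%C))).
  by congr cint; apply/funext => t; ring.
rewrite cintD ?cintZ ?mulNr //; try exact: box_inner_integrable.
rewrite (_ : (fun t => _) =
  (fun t => box t * ((fun t => - c * h t) t * (k t)^*%C))).
  by apply: box_inner_integrable => //; exact: locbZ.
by apply/funext => t; ring.
Qed.

Lemma box_inner_expo l l' :
  box_inner (expo l) (expo l') = if l == l' then (T%:C)%C else 0.
Proof.
rewrite -subr_eq0 -expo_orthogonal; congr cint; apply/funext => t.
congr (_ * _); rewrite /expo cexpi_conj -cexpiD; congr cexpi.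
by rewrite rmorphB /=; ring.
Qed.

Lemma box_inner_ge0 f : 0 <= complex.Re (box_inner f f).
Proof.
rewrite /box_inner /cint /cintegral /=; apply: Rintegral_ge0 => t _.
by rewrite mulc_conj complexReM /= mulr0 subr0 mulr_ge0 ?sqr_ge0.
Qed.

(** Subtract from [F] its projections onto the exponentials one at a time: each
    step lowers the squared norm by [T^-1] times the squared coefficient, and
    what remains is nonnegative. *)
Lemma bessel_box F (s : seq int) : locally_bounded F -> uniq s ->
  T^-1 * \sum_(l <- s) cmod (box_inner F (expo l)) ^+ 2 <= complex.Re (box_inner F F).
Proof.
move=> lF us; pose u l := box_inner F (expo l).
(* The part of F orthogonal to the exponentials listed in s. *)
pose H (s : seq int) t := F t - \sum_(l <- s) ((T^-1)%:C)%C * u l * expo l t.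
have lH r : locally_bounded (H r).
  rewrite /H; under eq_fun do rewrite -sumrN.
  apply: locbD => //; apply: locb_sum => l.
  under eq_fun do rewrite -mulNr; apply: locbZ; exact: locb_expo.
have HS l r : H (l :: r) = (fun t => H r t - ((T^-1)%:C)%C * u l * expo l t).
  by apply/funext => t; rewrite /H big_cons opprD addrA addrAC.
have Hex r l : l \notin r -> box_inner (H r) (expo l) = u l.
  elim: r => [_|l' r IH].
    by rewrite /u /H; congr box_inner; apply/funext => t; rewrite big_nil subr0.
  rewrite inE negb_or => /andP[ll' lr]; rewrite HS box_innerBZl //; try exact: locb_expo.
  by rewrite IH // box_inner_expo eq_sym (negbTE ll') mulr0 subr0.
have key r : uniq r -> complex.Re (box_inner (H r) (H r)) =
    complex.Re (box_inner F F) - T^-1 * \sum_(l <- r) cmod (u l) ^+ 2.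
  elim: r => [_|l r IH]; last rewrite cons_uniq => /andP[lr ur].
    rewrite big_nil mulr0 subr0; congr (complex.Re (box_inner _ _));
    by apply/funext => t; rewrite /H big_nil subr0.
  have lHS := lH (l :: r).
  have c1 : box_inner (expo l) (H r) = (u l)^*%C.
    by rewrite (box_inner_conj (H r)) ?Hex //; exact: locb_expo.
  have Tc : ((T^-1)%:C)%C * (T%:C)%C = 1 :> R[i].
    by rewrite -rmorphM /= mulVf ?gt_eqF.
  have c2 : box_inner (H (l :: r)) (expo l) = 0.
    rewrite HS box_innerBZl ?Hex //; try exact: locb_expo.
    by rewrite box_inner_expo eqxx mulrAC Tc mul1r subrr.
  have c3 : box_inner (H (l :: r)) (H (l :: r)) =
      box_inner (H r) (H r) - (((T^-1) * cmod (u l) ^+ 2)%:C)%C.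
    rewrite {1}HS box_innerBZl //; last exact: locb_expo.
    rewrite (box_inner_conj (H (l :: r)) (expo l)) ?c2 ?conjc0 ?mulr0 ?subr0 //;
      last exact: locb_expo.
    rewrite (box_inner_conj (H (l :: r)) (H r)) // HS box_innerBZl //; last exact: locb_expo.
    rewrite c1 -mulrA mulc_conj conjc_sub -(box_inner_conj (H r)) //.
    by rewrite -(rmorphM (real_complex R)) conjc_real.
  transitivity (complex.Re (box_inner (H r) (H r)) - T^-1 * cmod (u l) ^+ 2).
    by rewrite c3 complexReD.
  by rewrite IH // big_cons mulrDr opprD addrA addrAC.
have := box_inner_ge0 (H s); rewrite key // subr_ge0; exact.
Qed.

End Bessel.

(** * Sets on which the translates are nearly degenerate *)
Section DegenerateSet.
Context {R : realType}.
Context (g : R -> R[i]) (lg : locally_bounded g) (alpha T : R) (T0 : 0 < T).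
Context (E : set (measurableTypeR R)) (mE : measurable E).
Context (ET : E `<=` `[0, T[%classic).

Let mu := @lebesgue_measure R.

Definition chi (t : R) : R[i] := ((\1_E t : R)%:C)%C.

Lemma chi_in t : E t -> chi t = 1.
Proof. by move=> Et; rewrite /chi indicE mem_set. Qed.

Lemma chi_out t : ~ E t -> chi t = 0.
Proof. by move=> Et; rewrite /chi indicE memNset. Qed.

Lemma box_chi t : box T t * chi t = chi t.
Proof.
have [Et|Et] := pselect (E t); last by rewrite chi_out // mulr0.
by rewrite chi_in // /box indicE mem_set ?mulr1 //; exact: ET.
Qed.

Lemma locb_chi : locally_bounded chi.
Proof. exact: locb_indic. Qed.

Lemma mu_fin : mu E \is a fin_num.
Proof.
rewrite ge0_fin_numE //; apply: (@le_lt_trans _ _ (mu `[0, T[%classic)).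
  by apply: le_measure; rewrite ?inE.
by rewrite /mu lebesgue_measure_itv /= lte_fin T0 -EFinB ltry.
Qed.

Lemma chi_integrable f : locally_bounded f -> cintegrable (fun t => chi t * f t).
Proof.
move=> lf; rewrite (_ : (fun _ => _) = (fun t => box T t * (chi t * f t))).
  by apply: box_integrable => //; apply: locbM => //; exact: locb_chi.
by apply/funext => t; rewrite mulrA box_chi.
Qed.

Lemma cint_chi : cint chi = ((fine (mu E))%:C)%C.
Proof.
rewrite /cint /cintegral; congr Complex.
  by rewrite /Rintegral integral_indic // setIT.
by rewrite Rintegral_cst // mul0r.
Qed.

Lemma chi_integrable1 : cintegrable chi.
Proof.
rewrite (_ : chi = fun t => chi t * 1); last by apply/funext => t; rewrite mulr1.
by apply: (@chi_integrable (fun=> 1)); exact: locb_cst.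
Qed.

Context (M : nat) (c : nat -> R[i]).

(** The translates of [E] by multiples of [T] are pairwise disjoint, so this
    function is constant on each of them and its norm is explicit.  The
    conjugates compensate for the one in [inner]. *)
Definition test_fun (x : R) : R[i] := \sum_(i < M) (c i)^*%C * chi (x - i%:R * T).

Lemma chi_shift_far f (i : 'I_M) (t : R) : locally_bounded f ->
  (M%:R * T < `|t|) ->
  chi (t - i%:R * T) * f t = 0.
Proof.
move=> lf Mt; rewrite chi_out ?mul0r // => /ET; rewrite /= in_itv /=.
move=> /andP[h1 h2]; have iT0 : 0 <= i%:R * T by rewrite mulr_ge0 // ltW.
have t0 : 0 <= t by lra.
have : i%:R * T + T <= M%:R * T.
  by rewrite -[X in _ + X]mul1r -mulrDl ler_wpM2r ?(ltW T0) // natr1 ler_nat.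
by move: Mt; rewrite ger0_norm // => h3 h4; lra.
Qed.

Lemma chi_shift_integrable f (i : 'I_M) : locally_bounded f ->
  cintegrable (fun t => chi (t - i%:R * T) * f t).
Proof.
move=> lf; apply: (@locb_integrable _ _ (M%:R * T)); last first.
  by move=> t; exact: chi_shift_far.
by apply: locbM => //; apply: (@locb_shift _ chi); exact: locb_chi.
Qed.

Lemma locb_test_fun : locally_bounded test_fun.
Proof.
apply: locb_sum => i; apply: locbZ; apply: (@locb_shift _ chi); exact: locb_chi.
Qed.

Lemma cint_chi_shift f (i : 'I_M) : locally_bounded f ->
  cint (fun x => chi (x - i%:R * T) * f x) =
  cint (fun t => chi t * f (t + i%:R * T)).
Proof.
move=> lf.
have lF : locally_bounded (fun t => chi t * f (t + i%:R * T)).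
  by apply: locbM; [exact: locb_chi|exact: locb_shift].
have shE : (fun x => chi (x - i%:R * T) * f x) =
    (fun x => (fun t => chi t * f (t + i%:R * T)) (x - i%:R * T)).
  by apply/funext => x; rewrite subrK.
rewrite shE; apply: (@cint_shift _ (fun t => chi t * f (t + i%:R * T))
  (- (i%:R * T)) lF).
  by apply: chi_integrable; exact: locb_shift.
by rewrite -shE; exact: chi_shift_integrable.
Qed.

Lemma sqr_cmod_test_fun x :
  ((cmod (test_fun x) ^+ 2)%:C)%C =
  \sum_(i < M) ((cmod (c i) ^+ 2)%:C)%C * chi (x - i%:R * T).
Proof.
have [[i Ei]|nE] := pselect (exists i : 'I_M, E (x - i%:R * T)); last first.
  have h (i : 'I_M) : chi (x - i%:R * T) = 0.
    by apply: chi_out => Ei; apply: nE; exists i.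
  rewrite /test_fun !big1 => [|i _|i _]; rewrite ?h ?mulr0 // cmod0 expr0n //.
have h (k : 'I_M) : k != i -> chi (x - k%:R * T) = 0.
  move=> ki; apply: chi_out => Ek.
  have := ET _ Ek; have := ET _ Ei; rewrite /= !in_itv /=.
  move=> /andP[a1 a2] /andP[b1 b2].
  have h1 : i%:R * T < (k.+1)%:R * T :> R by rewrite -natr1 mulrDl mul1r; lra.
  have h2 : k%:R * T < (i.+1)%:R * T :> R by rewrite -natr1 mulrDl mul1r; lra.
  move: h1 h2; rewrite !ltr_pM2r // !ltr_nat !ltnS => h1 h2.
  by move/eqP: ki; apply; apply/val_inj/eqP; rewrite eqn_leq h1 h2.
rewrite /test_fun (bigD1 i) //= big1 ?addr0; last by move=> k /h ->; rewrite mulr0.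
rewrite [RHS](bigD1 i) //= big1 ?addr0; last by move=> k /h ->; rewrite mulr0.
by rewrite chi_in // !mulr1 cmod_conj.
Qed.

Let S : R := \sum_(i < M) cmod (c i) ^+ 2.

Lemma integral_sqr_test_fun :
  cintegrable (fun x => ((cmod (test_fun x) ^+ 2)%:C)%C) /\
  cint (fun x => ((cmod (test_fun x) ^+ 2)%:C)%C) = ((S * fine (mu E))%:C)%C.
Proof.
rewrite (funext sqr_cmod_test_fun).
have h (i : 'I_M) :
    cintegrable (fun x => ((cmod (c i) ^+ 2)%:C)%C * chi (x - i%:R * T)).
  under eq_fun do rewrite mulrC; apply: (@chi_shift_integrable (fun=> _)).
  exact: locb_cst.
have [-> I] := cint_sum _ (index_enum 'I_M) (fun i : 'I_M => fun x =>
  ((cmod (c i) ^+ 2)%:C)%C * chi (x - i%:R * T)) h.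
split=> //; rewrite /S mulr_suml rmorph_sum; apply: eq_bigr => i _.
under eq_fun do rewrite mulrC.
rewrite (@cint_chi_shift (fun=> _)); last exact: locb_cst.
under eq_fun do rewrite mulrC.
by rewrite cintZ ?cint_chi ?rmorphM //; exact: chi_integrable1.
Qed.

Lemma cLnorm_test_fun : cLfun (@lebesgue_measure R) 2 test_fun /\
  (cLnorm (@lebesgue_measure R) 2 test_fun ^+ 2 = (S * fine (mu E))%:E)%E.
Proof.
have [[I _] J] := integral_sqr_test_fun.
have P2 : (cLnorm (@lebesgue_measure R) 2 test_fun `^ 2 = (S * fine (mu E))%:E)%E.
  rewrite /cLnorm poweR_Lnorm ?pnatr_eq0 //.
  transitivity (\int[@lebesgue_measure R]_x
      (EFin \o (fun x => (cmod (test_fun x) ^+ 2)%R)) x)%E.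
    apply: eq_integral => x _ /=.
    by rewrite ger0_norm ?cmod_ge0 // powR_mulrn // cmod_ge0.
  rewrite -[LHS]fineK; last exact: (integrable_fin_num measurableT I).
  congr EFin; by have := congr1 (@complex.Re R) J.
have n0 := Lnorm_ge0 (@lebesgue_measure R) 2%:E (fun x => (cmod (test_fun x))%:E).
have fin : (cLnorm (@lebesgue_measure R) 2 test_fun < +oo)%E.
  apply: (@lty_poweRy _ _ 2); first by rewrite pnatr_eq0.
  by rewrite P2 ltry.
split; first by split=> //; case: locb_test_fun.
rewrite -P2; move: n0 fin; rewrite -/(cLnorm _ _ _).
case: (cLnorm _ _ _) => // x; rewrite lee_fin => x0 _.
by rewrite poweR_EFin powR_mulrn.
Qed.

Definition gabor_sum (k : int) (t : R) : R[i] :=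
  chi t * (\sum_(i < M) c i * g (t + i%:R * T - alpha * k%:~R))^*%C.

Lemma locb_translate (a : R) : locally_bounded (fun t => g (t - a)).
Proof. exact: (@locb_shift _ g). Qed.

Lemma locb_gabor_sum k : locally_bounded (gabor_sum k).
Proof.
apply: locbM; first exact: locb_chi.
apply: (@locb_conj _ (fun t => _)); apply: locb_sum => i; apply: locbZ.
under eq_fun do rewrite -addrA.
exact: (@locb_shift _ g).
Qed.

(** Move the [i]-th summand of the test function back to [E] by a translation;
    the exponentials have period [T] and do not notice it. *)
Lemma inner_gabor k l :
  inner test_fun (gabor_system g alpha T^-1 (k, l)) = box_inner T (gabor_sum k) (expo T l).
Proof.
pose G (x : R) := (expo T l x * g (x - alpha * k%:~R))^*%C.
have lG : locally_bounded G.
  apply: (@locb_conj _ (fun x => _)); apply: locbM; first exact: locb_expo.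
  exact: locb_translate.
have exP (i : nat) (t : R) : expo T l (t + i%:R * T) = expo T l t.
  rewrite /expo mulrDr cexpiD.
  have -> : 2 * pi / T * l%:~R * (i%:R * T) = 2 * pi * (l * i%:Z)%:~R :> R.
    by rewrite rmorphM /= -pmulrn; field; rewrite gt_eqF.
  by rewrite cexpi_2pi mulr1.
have -> : inner test_fun (gabor_system g alpha T^-1 (k, l)) =
    cint (fun x => \sum_(i < M) (c i)^*%C * (chi (x - i%:R * T) * G x)).
  rewrite /inner /cint; congr cintegral; apply/funext => x.
  by rewrite /test_fun mulr_suml; apply: eq_bigr => i _; rewrite mulrA.
have h (i : 'I_M) : cintegrable (fun x => (c i)^*%C * (chi (x - i%:R * T) * G x)).
  under eq_fun do rewrite mulrCA; apply: chi_shift_integrable; exact: locbZ.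
have [-> _] := cint_sum _ (index_enum 'I_M) _ h.
have h' (i : 'I_M) : cintegrable (fun t => (c i)^*%C * (chi t * G (t + i%:R * T))).
  under eq_fun do rewrite mulrCA; apply: chi_integrable; apply: locbZ.
  exact: locb_shift.
transitivity (\sum_(i < M) cint (fun t => (c i)^*%C * (chi t * G (t + i%:R * T)))).
  apply: eq_bigr => i _; rewrite !cintZ ?cint_chi_shift //.
    by apply: chi_integrable; exact: locb_shift.
  exact: chi_shift_integrable.
have [<- _] := cint_sum _ (index_enum 'I_M) _ h'.
congr cint; apply/funext => t; rewrite mulrA [box T t * _]mulrA box_chi.
rewrite conjc_sum mulr_sumr mulr_suml; apply: eq_bigr => i _.
by rewrite /G exP !conjc_mul; ring.
Qed.

Context (C : R) (hC : forall t, E t -> forall K : seq int, uniq K ->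
  \sum_(k <- K) cmod (\sum_(i < M) c i * g (t + i%:R * T - alpha * k%:~R)) ^+ 2
    <= C).

Lemma sum_box_inner_gabor_sum (K : seq int) : uniq K ->
  \sum_(k <- K) complex.Re (box_inner T (gabor_sum k) (gabor_sum k)) <= C * fine (mu E).
Proof.
move=> uK; rewrite -Re_sum.
have h (k : int) :=
  @box_inner_integrable R T _ _ (locb_gabor_sum k) (locb_gabor_sum k).
have [<- [I _]] := cint_sum _ K (fun k t =>
  box T t * (gabor_sum k t * (gabor_sum k t)^*%C)) h.
have -> : C * fine (mu E) = Rintegral mu setT (fun t => C * \1_E t).
  have [J _] := chi_integrable1.
  rewrite (@RintegralZl _ _ _ _ _ (fun t => \1_E t)) //.
  by congr (_ * _); rewrite /Rintegral integral_indic // setIT.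
apply: le_Rintegral => //.
  have [J _] := chi_integrable1.
  exact: (@integrableZl _ _ _ mu setT measurableT C _ J).
move=> t _; rewrite Re_sum.
have [Et|Et] := pselect (E t); last first.
  rewrite big1 ?indicE ?memNset ?mulr0 // => k _.
  by rewrite /gabor_sum chi_out // !mul0r mulr0.
rewrite indicE mem_set // mulr1; apply: le_trans (hC _ Et _ uK).
apply: le_of_eq; apply: eq_bigr => k _.
rewrite /gabor_sum mulc_conj cmodM cmod_conj chi_in // -[1]/((1%:C)%C).
rewrite cmod_real normr1 mul1r.
by rewrite complexReM /= mulr0 subr0 indicE mem_set ?mul1r //; exact: ET.
Qed.

Lemma frame_sum_le :
  (\esum_(i in [set: int * int])
     ((cmod (inner test_fun (gabor_system g alpha T^-1 i))) ^+ 2)%:E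
   <= (T * (C * fine (mu E)))%:E)%E.
Proof.
apply: ge_ereal_sup => _ [X [finX _] <-].
rewrite fsbig_finite // sumEFin lee_fin.
set s := (X in \sum_(_ <- X) _).
pose K := undup [seq x.1 | x <- s]; pose L := undup [seq x.2 | x <- s].
apply: (@le_trans _ _ (\sum_(x <- [seq (k, l) | k <- K, l <- L])
   cmod (inner test_fun (gabor_system g alpha T^-1 x)) ^+ 2)).
  apply: sum_sub_le => [||x xs|x].
  - exact: fset_uniq.
  - by apply: allpairs_uniq; rewrite ?undup_uniq // => -[a b] [a' b'] _ _.
  - apply/allpairsP; exists x; rewrite !mem_undup; split; last by case: x {xs}.
      by apply/mapP; exists x.
    by apply/mapP; exists x.
  - exact: sqr_ge0.
rewrite big_allpairs.
apply: (@le_trans _ _ (\sum_(k <- K)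
   T * complex.Re (box_inner T (gabor_sum k) (gabor_sum k)))).
  apply: ler_sum => k _; under eq_bigr do rewrite inner_gabor.
  rewrite -ler_pdivrMl //; apply: bessel_box => //; last exact: undup_uniq.
  exact: locb_gabor_sum.
rewrite -mulr_sumr ler_wpM2l ?(ltW T0) //.
apply: sum_box_inner_gabor_sum; exact: undup_uniq.
Qed.

(** The lower frame bound at the test function reads
    [A S |E| <= T C |E|]. *)
Lemma degenerate_set_null (A : R) :
  (A%:E * cLnorm (@lebesgue_measure R) 2 test_fun ^+ 2 <=
   \esum_(i in [set: int * int])
     ((cmod (inner test_fun (gabor_system g alpha T^-1 i))) ^+ 2)%:E)%E ->
  T * C < A * S -> mu E = 0%E.
Proof.
move=> hA TC; have := le_trans hA frame_sum_le.
rewrite (proj2 cLnorm_test_fun) -EFinM lee_fin => h.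
have m0 : 0 <= fine (mu E) by exact: fine_ge0.
have : fine (mu E) = 0.
  apply/eqP; rewrite eq_le m0 andbT leNgt; apply/negP => m1.
  have : T * C * fine (mu E) < A * S * fine (mu E) by rewrite ltr_pM2r.
  by rewrite ltNge; apply/negP; rewrite negbK; rewrite mulrA mulrA in h.
by move=> m; rewrite -(fineK mu_fin) m.
Qed.

End DegenerateSet.

(** * Covering a period by null sets *)
Lemma sum_blocks (V : nmodType) (N p : nat) (F : nat -> V) :
  \sum_(i < N * p) F i = \sum_(i < N) \sum_(s < p) F (i * p + s)%N.
Proof.
rewrite -(big_mkord xpredT F) big_nat_mul big_mkord; apply: eq_bigr => i _.
rewrite -{1}(add0n (i * p)%N) big_addn mulSn addnK big_mkord.
by apply: eq_bigr => s _; rewrite addnC.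
Qed.

Lemma measurable_sublevel {R : realType} (g : R -> R[i]) (lg : locally_bounded g)
    (alpha T C : R) (M : nat) (c : nat -> R[i]) (K : seq int) :
  @measurable _ (measurableTypeR R) [set t : measurableTypeR R |
    \sum_(k <- K) cmod (\sum_(i < M) c i * g (t + i%:R * T - alpha * k%:~R)) ^+ 2
    <= C].
Proof.
pose F k (t : R) := \sum_(i < M) c i * g (t + i%:R * T - alpha * k%:~R).
have lF k : locally_bounded (F k).
  apply: locb_sum => i; apply: locbZ; under eq_fun do rewrite -addrA.
  exact: (@locb_shift _ g).
have lH : locally_bounded (fun t => \sum_(k <- K) F k t * (F k t)^*%C).
  by apply: locb_sum => k; apply: locbM => //; exact: locb_conj.
have [[mH _] _] := lH.
have := mH measurableT `]-oo, C]%classic (measurable_itv _).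
rewrite setTI; congr measurable; apply/funext => t; rewrite /= in_itv /= Re_sum.
by congr (is_true (_ <= _)); apply: eq_bigr => k _; rewrite mulc_conj.
Qed.

Lemma negligible_bigcup_count d (X : measurableType d) (R : realType)
    (mu : {measure set X -> \bar R}) (I : countType) (F : I -> set X) :
  (forall i, mu.-negligible (F i)) -> mu.-negligible (\bigcup_i F i).
Proof.
move=> nF; apply: (@negligibleS _ _ _ _
    (\bigcup_n oapp F set0 (choice.unpickle n : option I))).
  by move=> x [i _ Fix]; exists (choice.pickle i) => //; rewrite choice.pickleK.
apply: negligible_bigcup => n; case: (choice.unpickle n) => [i|] /=.
  exact: nF.
exact: negligible_set0.
Qed.

Theorem proposition2 (R : realType) (g : R -> R[i])
    (hg : feichtinger g)
    (gcont : continuous (g : R -> R[i]^o))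
    (gpu : partition_of_unity g)
    (m n r j : nat)
    (hj : (1 <= j <= r - 1)%N)
    (hlt : ((r - 1) * m + 1 < r * n + j < r * m)%N)
    (hcop : coprime (r * n + j) (r * m))
    (alpha beta : R)
    (halpha : alpha = 1 / m%:R)
    (hbeta : beta = n%:R + j%:R / r%:R) :
  ~ is_frame (gabor_system g alpha beta).
Proof.
move=> [A [B [A0 _ frame]]]; have lg := continuous_locb _ gcont.
have r0 : (0 < r)%N by lia.
have m0 : (0 < m)%N by move: hlt; case: m {hcop halpha} => //; rewrite muln0; lia.
move: hlt => /andP[mrp _]; set p := (r * n + j)%N in mrp *.
have p0 : (0 < p)%N by apply: leq_ltn_trans mrp.
have pR : p%:R != 0 :> R by rewrite pnatr_eq0 -lt0n.
have rR : r%:R != 0 :> R by rewrite pnatr_eq0 -lt0n.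
pose T : R := r%:R / p%:R.
have T0 : 0 < T by rewrite divr_gt0 // ltr0n.
have bT : beta = T^-1.
  by rewrite hbeta invf_div natrD natrM; field.
(* With this choice T C is half of A S in degenerate_set_null. *)
pose eta := A / (2 * T).
have eta0 : 0 < eta by rewrite divr_gt0 // mulr_gt0.
pose S (D : {ffun 'I_p -> rat * rat}) : R := \sum_s cmod (cratr (D s) : R[i]) ^+ 2.
pose c (D : {ffun 'I_p -> rat * rat}) (i : nat) : R[i] :=
  cratr (D (Ordinal (ltn_pmod i p0))).
have cE D i (s : 'I_p) : c D (i * p + s)%N = cratr (D s).
  by rewrite /c; congr (cratr (D _)); apply/val_inj; rewrite /= modnMDl modn_small.
pose lev N D (K : seq int) : set (measurableTypeR R) := [set t |
  \sum_(k <- K) cmod (\sum_(i < N * p) c D i * g (t + i%:R * T - alpha * k%:~R)) ^+ 2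
    <= eta * (N%:R * S D)].
pose E N D : set (measurableTypeR R) :=
  [set t | `[0, T[%classic t /\ forall K, uniq K -> lev N D K t].
have mE N D : measurable (E N D).
  have -> : E N D = `[0, T[%classic `\`
      \bigcup_(K : {K : seq int | uniq K}) ~` lev N D (val K).
    apply/seteqP; split=> t [tT h]; split=> //.
      by move=> [[K uK] _]; apply; exact: h.
    by move=> K uK; apply: contrapT => nK; apply: h; exists (exist _ K uK).
  apply: measurableD; first exact: measurable_itv.
  apply: countable_bigcupT_measurable => // K.
  by apply: measurableC; exact: measurable_sublevel.
have nullE N D : (0 < N)%N -> 0 < S D -> lebesgue_measure (E N D) = 0%E.
  move=> N0 S0.
  have SE : \sum_(i < N * p) cmod (c D i) ^+ 2 = N%:R * S D.
    rewrite (sum_blocks _ N p (fun i => cmod (c D i) ^+ 2)).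
    under eq_bigr => i _ do under eq_bigr => s _ do rewrite cE.
    by rewrite sumr_const card_ord mulr_natl.
  have ET : E N D `<=` `[0, T[%classic by move=> t [].
  have [Lf _] := cLnorm_test_fun T T0 _ (mE N D) ET (N * p) (c D).
  have [lower _] := andP (frame _ Lf).
  rewrite bT in lower.
  apply: (degenerate_set_null g lg alpha T T0 _ (mE N D) ET _ _
    (eta * (N%:R * S D)) _ _ lower).
    by move=> t [_ h] K /h.
  rewrite SE mulrA ltr_pM2r; last by rewrite mulr_gt0 // ltr0n.
  have -> : T * eta = A / 2 by rewrite /eta; field; rewrite gt_eqF.
  lra.
pose U (x : nat * {ffun 'I_p -> rat * rat}) : set (measurableTypeR R) :=
  if (0 < x.1)%N && (0 < S x.2) then E x.1 x.2 else set0.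
have nullU : (@lebesgue_measure R).-negligible (\bigcup_x U x).
  apply: negligible_bigcup_count => -[N D]; rewrite /U /=.
  case: ifP => [/andP[N0 S0]|_]; last exact: negligible_set0.
  by apply/negligibleP => //; exact: nullE.
have cover : `[0, T[%classic `<=` \bigcup_x U x.
  move=> t tT.
  have [N [D [N0 S0 h]]] :=
    degenerate_combination g gpu m r p m0 r0 mrp t eta eta0.
  exists (N, D) => //; rewrite /U /= N0 S0 /=.
  split => // K /h; rewrite /lev /=.
  congr (_ <= _); apply: eq_bigr => k _; congr (cmod _ ^+ 2).
  rewrite (sum_blocks _ N p (fun i => c D i * g (t + i%:R * T - alpha * k%:~R))).
  apply: eq_bigr => i _; apply: eq_bigr => s _; rewrite cE; congr (_ * g _).
  rewrite natrD natrM halpha /T; field.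
  by rewrite pR pnatr_eq0 -lt0n m0.
have T_null : (@lebesgue_measure R).-negligible
    (`[0, T[%classic : set (measurableTypeR R)).
  by apply: negligibleS nullU; exact: cover.
have : (@lebesgue_measure R) `[0, T[%classic = 0%E.
  by apply/negligibleP.
rewrite lebesgue_measure_itv /= lte_fin T0 -EFinB subr0 => /eqP.
by rewrite eqe gt_eqF.
Qed.
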